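(* Let $Q=\{(x,y,z)\in\mathbb{R}^3 : x^2/a+y^2/b+z^2/c=1\}$ with $0<c<b<a$, and consider nonsingular periodic billiard trajectories inside $Q$. Assume the following conjecture: the winding numbers $m_0,m_1,m_2$ of every nonsingular periodic billiard trajectory inside $Q$ satisfy $m_2<m_1<m_0$. Then every periodic billiard trajectory inside $Q$ whose caustics are of type EH1, H1H1, EH2, and H1H2 has period at least five, four, five, and six, respectively.
   Context: The confocal family is $Q_\lambda=\{x^2/(a-\lambda)+y^2/(b-\lambda)+z^2/(c-\lambda)=1\}$. Every line of a billiard trajectory inside $Q$ is tangent to the same two confocal quadrics $Q_{\lambda_1},Q_{\lambda_2}$ (the caustics), $\lambda_1<\lambda_2$. The trajectory is nonsingular when $\lambda_1,\lambda_2\notin\{a,b,c\}$ and $0<\lambda_1<\lambda_2$. $Q_\lambda$ is an ellipsoid (E) for $\lambda\in(0,c)$, a one-sheet hyperboloid (H1) for $\lambda\in(c,b)$, a two-sheet hyperboloid (H2) for $\lambda\in(b,a)$; the type of the trajectory is the pair of caustic types (EH1: $\lambda_1\in(0,c),\lambda_2\in(c,b)$; H1H1: $c<\lambda_1<\lambda_2<b$; EH2: $\lambda_1\in(0,c),\lambda_2\in(b,a)$; H1H2: $\lambda_1\in(c,b),\lambda_2\in(b,a)$). Winding numbers: order $\{a,b,c,\lambda_1,\lambda_2\}$ as $c_1<\dots<c_5$, set $c_0=0$, and let $Q_{c_0}=Q$, $Q_a,Q_b,Q_c$ be the coordinate planes $x=0$, $y=0$, $z=0$ respectively. A nonsingular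 periodic trajectory has winding numbers $m_0,m_1,m_2$ if along one period it has exactly $m_j$ points on $Q_{c_{2j}}$ and $m_j$ points on $Q_{c_{2j+1}}$ (impacts with $Q$, tangencies with caustics, crossings of coordinate planes); $m_0$ is the period. *)

(* Defs.v *)
From Stdlib Require Import Reals Lra List Permutation.
Open Scope R_scope.

Record pt := Pt { px : R; py : R; pz : R }.

Definition padd (u v : pt) : pt := Pt (px u + px v) (py u + py v) (pz u + pz v).
Definition psub (u v : pt) : pt := Pt (px u - px v) (py u - py v) (pz u - pz v).
Definition pscale (s : R) (u : pt) : pt := Pt (s * px u) (s * py u) (s * pz u).
Definition dot (u v : pt) : R := px u * px v + py u * py v + pz u * pz v.
Definition pnorm (u : pt) : R := sqrt (dot u u).
Definition unit (u : pt) : pt := pscale (/ pnorm u) u.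

Definition onQ (a b c : R) (P : pt) : Prop :=
  px P ^ 2 / a + py P ^ 2 / b + pz P ^ 2 / c = 1.

(* The confocal family Q_lambda; by the paper's convention Q_a, Q_b, Q_c are
   the coordinate planes x = 0, y = 0, z = 0.  Note Q_0 = Q. *)
Definition confocal (a b c lam : R) (P : pt) : Prop :=
  if Req_EM_T lam a then px P = 0
  else if Req_EM_T lam b then py P = 0
  else if Req_EM_T lam c then pz P = 0
  else px P ^ 2 / (a - lam) + py P ^ 2 / (b - lam) + pz P ^ 2 / (c - lam) = 1.

(* Outward normal direction of Q at P (gradient up to the factor 2). *)
Definition normalQ (a b c : R) (P : pt) : pt := Pt (px P / a) (py P / b) (pz P / c).

Definition billiard_traj (a b c : R) (p : nat -> pt) : Prop :=
  (forall k, onQ a b c (p k)) /\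
  (forall k, p (S k) <> p k) /\
  (forall k,
     let u := unit (psub (p (S k)) (p k)) in
     let w := unit (psub (p (S (S k))) (p (S k))) in
     let N := normalQ a b c (p (S k)) in
     w = psub u (pscale (2 * dot u N / dot N N) N)).

Definition periodic_with (p : nat -> pt) (n : nat) : Prop :=
  (0 < n)%nat /\ forall k, p (k + n)%nat = p k.

(* The line through P with direction V is tangent to the confocal quadric
   Q_lam (lam not in {a,b,c}): the quadratic equation in t obtained by
   substituting P + t V into the equation of Q_lam has zero discriminant. *)
Definition line_tangent (a b c lam : R) (P V : pt) : Prop :=
  let A := px V ^ 2 / (a - lam) + py V ^ 2 / (b - lam) + pz V ^ 2 / (c - lam) in
  let B := px P * px V / (a - lam) + py P * py V / (b - lam) + pz P * pz V / (c - lam) in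
  let C := px P ^ 2 / (a - lam) + py P ^ 2 / (b - lam) + pz P ^ 2 / (c - lam) - 1 in
  B ^ 2 = A * C.

Definition has_caustics (a b c : R) (p : nat -> pt) (lam1 lam2 : R) : Prop :=
  lam1 < lam2 /\
  forall k, line_tangent a b c lam1 (p k) (psub (p (S k)) (p k)) /\
            line_tangent a b c lam2 (p k) (psub (p (S k)) (p k)).

Definition nonsingular_caustics (a b c lam1 lam2 : R) : Prop :=
  0 < lam1 /\ lam1 < lam2 /\
  lam1 <> a /\ lam1 <> b /\ lam1 <> c /\
  lam2 <> a /\ lam2 <> b /\ lam2 <> c.

Definition seg (p : nat -> pt) (k : nat) (t : R) : pt :=
  padd (p k) (pscale t (psub (p (S k)) (p k))).

Definition points_on (p : nat -> pt) (n : nat) (X : pt -> Prop) (m : nat) : Prop :=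
  exists l : list (nat * R),
    NoDup l /\ length l = m /\
    forall k t, In (k, t) l <-> ((k < n)%nat /\ 0 <= t < 1 /\ X (seg p k t)).

Definition winding_numbers (a b c : R) (p : nat -> pt) (n : nat)
    (lam1 lam2 : R) (m0 m1 m2 : nat) : Prop :=
  exists c1 c2 c3 c4 c5 : R,
    c1 < c2 /\ c2 < c3 /\ c3 < c4 /\ c4 < c5 /\
    Permutation (c1 :: c2 :: c3 :: c4 :: c5 :: nil) (a :: b :: c :: lam1 :: lam2 :: nil) /\
    points_on p n (confocal a b c 0) m0 /\
    points_on p n (confocal a b c c1) m0 /\
    points_on p n (confocal a b c c2) m1 /\
    points_on p n (confocal a b c c3) m1 /\
    points_on p n (confocal a b c c4) m2 /\
    points_on p n (confocal a b c c5) m2.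

Definition winding_conjecture (a b c : R) : Prop :=
  forall (p : nat -> pt) (n : nat) (lam1 lam2 : R) (m0 m1 m2 : nat),
    billiard_traj a b c p -> periodic_with p n ->
    has_caustics a b c p lam1 lam2 -> nonsingular_caustics a b c lam1 lam2 ->
    winding_numbers a b c p n lam1 lam2 m0 m1 m2 ->
    (m2 < m1 /\ m1 < m0)%nat.

Definition type_EH1 (a b c lam1 lam2 : R) : Prop := 0 < lam1 < c /\ c < lam2 < b.
Definition type_H1H1 (a b c lam1 lam2 : R) : Prop := c < lam1 /\ lam1 < lam2 /\ lam2 < b.
Definition type_EH2 (a b c lam1 lam2 : R) : Prop := 0 < lam1 < c /\ b < lam2 < a.
Definition type_H1H2 (a b c lam1 lam2 : R) : Prop := c < lam1 < b /\ b < lam2 < a.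

(* Main.v *)
(* On a line of the trajectory, clear denominators in the equation of Q_l at a
   point X: this gives a monic cubic [gam X l] whose roots m1, m2, m3 are the
   elliptic coordinates of X.  Tangency to the two caustics reads
     bil X V l ^ 2 - gam X l * bil V V l = - |V|^2 (l - c1) ... (l - c5),
   which confines m1 below c1, m2 to [c2,c3] and m3 to [c4,c5], and turns each
   t |-> gam (X + tV) c_i into a signed square of an affine function.
   For the gaps (u,v) = (c2,c3) and (c5,c4) the two affine functions x, y belonging
   to u and v describe a point (x,y) turning counterclockwise around the origin.
   The quadrant of (x,y), up to a half turn, is preserved by reflections: otherwise some
   quartic polynomial would alternate in sign at six points.  Hence the zeros
   of x and y alternate along the whole trajectory, so that periodicity gives equal
   numbers of them; there is at least one, since otherwise (x/y)^2 would be
   strictly monotone along a closed path.  In the gap [0,c1] each segment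
   has one impact and one zero.  Thus the winding numbers exist and m2 > 0;
   a winding number counting crossings of a coordinate plane is even, and the
   bounds follow from m2 < m1 < m0. *)

Require Import Defs.
From Stdlib Require Import Reals Psatz List Permutation.
Open Scope R_scope.

(** * Real polynomials *)

(* The fifth divided difference of a quartic vanishes. *)
Lemma quartic_alternation (k0 k1 k2 k3 k4 x0 x1 x2 x3 x4 x5 : R) :
  let K x := k0 + k1 * x + k2 * x ^ 2 + k3 * x ^ 3 + k4 * x ^ 4 in
  x0 < x1 -> x1 < x2 -> x2 < x3 -> x3 < x4 -> x4 < x5 ->
  K x0 <= 0 -> 0 <= K x1 -> K x2 <= 0 -> 0 < K x3 -> K x4 <= 0 -> 0 <= K x5 ->
  False.
Proof.
  intros K h1 h2 h3 h4 h5 H0 H1 H2 H3 H4 H5.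
  assert (E : - K x0 / ((x1-x0)*(x2-x0)*(x3-x0)*(x4-x0)*(x5-x0))
     + K x1 / ((x1-x0)*(x2-x1)*(x3-x1)*(x4-x1)*(x5-x1))
     + - K x2 / ((x2-x0)*(x2-x1)*(x3-x2)*(x4-x2)*(x5-x2))
     + K x3 / ((x3-x0)*(x3-x1)*(x3-x2)*(x4-x3)*(x5-x3))
     + - K x4 / ((x4-x0)*(x4-x1)*(x4-x2)*(x4-x3)*(x5-x4))
     + K x5 / ((x5-x0)*(x5-x1)*(x5-x2)*(x5-x3)*(x5-x4)) = 0).
  { unfold K. field. repeat split; lra. }
  assert (N : forall u v, 0 <= u -> 0 < v -> 0 <= u / v).
  { intros u v Hu Hv. apply Rmult_le_pos; [lra | left; apply Rinv_0_lt_compat; lra]. }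
  assert (P : 0 < K x3 / ((x3-x0)*(x3-x1)*(x3-x2)*(x4-x3)*(x5-x3))).
  { apply Rdiv_lt_0_compat; [lra|]. repeat apply Rmult_lt_0_compat; lra. }
  assert (Q : forall u y0 y1 y2 y3 y4, 0 <= u -> 0 < y0 -> 0 < y1 -> 0 < y2 -> 0 < y3 -> 0 < y4 ->
     0 <= u / (y0*y1*y2*y3*y4)).
  { intros. apply N; auto. repeat apply Rmult_lt_0_compat; lra. }
  pose proof (Q (- K x0) (x1-x0) (x2-x0) (x3-x0) (x4-x0) (x5-x0) ltac:(lra) ltac:(lra) ltac:(lra) ltac:(lra) ltac:(lra) ltac:(lra)).
  pose proof (Q (K x1) (x1-x0) (x2-x1) (x3-x1) (x4-x1) (x5-x1) ltac:(lra) ltac:(lra) ltac:(lra) ltac:(lra) ltac:(lra) ltac:(lra)).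
  pose proof (Q (- K x2) (x2-x0) (x2-x1) (x3-x2) (x4-x2) (x5-x2) ltac:(lra) ltac:(lra) ltac:(lra) ltac:(lra) ltac:(lra) ltac:(lra)).
  pose proof (Q (- K x4) (x4-x0) (x4-x1) (x4-x2) (x4-x3) (x5-x4) ltac:(lra) ltac:(lra) ltac:(lra) ltac:(lra) ltac:(lra) ltac:(lra)).
  pose proof (Q (K x5) (x5-x0) (x5-x1) (x5-x2) (x5-x3) (x5-x4) ltac:(lra) ltac:(lra) ltac:(lra) ltac:(lra) ltac:(lra) ltac:(lra)).
  lra.
Qed.

Lemma Rmult_pos_reg_le (x y : R) : 0 < x -> 0 <= x * y -> 0 <= y.
Proof. intros. apply (Rmult_le_reg_l x); lra. Qed.

Lemma pow2_pos (x : R) : x <> 0 -> 0 < x ^ 2.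
Proof. intros H. apply Rsqr_pos_lt in H. unfold Rsqr in H. lra. Qed.

Lemma quadratic_factor (p q m : R) :
  m ^ 2 + p * m + q <= 0 ->
  exists r s, r <= m /\ m <= s /\ forall x, x ^ 2 + p * x + q = (x - r) * (x - s).
Proof.
  intros H.
  assert (D : 0 <= p ^ 2 / 4 - q) by (pose proof (pow2_ge_0 (m + p / 2)); lra).
  set (e := sqrt (p ^ 2 / 4 - q)).
  assert (E : e * e = p ^ 2 / 4 - q) by (apply sqrt_sqrt; exact D).
  assert (E0 : 0 <= e) by apply sqrt_pos.
  exists (- p / 2 - e), (- p / 2 + e). split; [nra|split; [nra|]].
  intros x. replace q with (p ^ 2 / 4 - e * e) by lra. field.
Qed.

(** The intermediate value theorem gives a root in [[b,a]]; after division by its linear factor, the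
    quadratic left is nonpositive at [c], so its roots lie on both sides of [c]. The case [f b = 0]
    is separate because the last root is then compared with [b] directly, on either side. *)
Lemma cubic_interlacing (p q r a b c : R) :
  let f x := x ^ 3 + p * x ^ 2 + q * x + r in
  c < b -> b < a -> 0 <= f c -> f b <= 0 -> 0 <= f a ->
  exists m1 m2 m3, m1 <= c /\ c <= m2 <= b /\ b <= m3 <= a /\
    forall x, f x = (x - m1) * (x - m2) * (x - m3).
Proof.
  intros f hcb hba Hc Hb Ha.
  assert (Div : forall e x, f e = 0 ->
    f x = (x - e) * (x ^ 2 + (p + e) * x + (q + e * (p + e)))).
  { intros e x He. unfold f in *.
    replace r with (- (e ^ 3 + p * e ^ 2 + q * e)) by lra. ring. }
  destruct (Req_dec (f b) 0) as [Zb|Zb].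
  - destruct (quadratic_factor (p + b) (q + b * (p + b)) c) as (r1 & s & h1 & h2 & Hf).
    { pose proof (Div b c Zb) as E.
      enough (0 <= - (c ^ 2 + (p + b) * c + (q + b * (p + b)))) by lra.
      apply (Rmult_pos_reg_le (b - c)); lra. }
    assert (Hs : s <= a).
    { pose proof (Div b a Zb) as E. rewrite Hf in E.
      assert (0 <= a - s); [|lra].
      apply (Rmult_pos_reg_le (a - r1)); [lra|].
      apply (Rmult_pos_reg_le (a - b)); lra. }
    assert (F : forall x, f x = (x - b) * ((x - r1) * (x - s))).
    { intros x. rewrite (Div b x Zb), Hf. reflexivity. }
    destruct (Rle_dec s b).
    + exists r1, s, b. repeat split; try lra. intros x. rewrite F. ring.
    + exists r1, b, s. repeat split; try lra. intros x. rewrite F. ring.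
  - destruct (IVT_cor f b a) as (m3 & h3 & Z3).
    { unfold f. intros x. reg. }
    { lra. }
    { pose proof (Rmult_le_compat_neg_l (f b) 0 (f a)); lra. }
    assert (b <> m3) by (intros E; rewrite E in Zb; auto).
    destruct (quadratic_factor (p + m3) (q + m3 * (p + m3)) c) as (r1 & s & h1 & h2 & Hf).
    { pose proof (Div m3 c Z3) as E.
      enough (0 <= - (c ^ 2 + (p + m3) * c + (q + m3 * (p + m3)))) by lra.
      apply (Rmult_pos_reg_le (m3 - c)); lra. }
    assert (F : forall x, f x = (x - m3) * ((x - r1) * (x - s))).
    { intros x. rewrite (Div m3 x Z3), Hf. reflexivity. }
    exists r1, s, m3. repeat split; try lra.
    + pose proof (F b) as E. enough (0 <= b - s) by lra.
      apply (Rmult_pos_reg_le (b - r1)); [lra|].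
      apply (Rmult_pos_reg_le (m3 - b)); lra.
    + intros x. rewrite F. ring.
Qed.

Lemma continuous_root (f : R -> R) (e : R) :
  continuity_pt f e -> (forall x, x <> e -> f x = 0) -> f e = 0.
Proof.
  intros C H. destruct (Req_dec (f e) 0) as [|N]; [assumption|exfalso].
  destruct (C (Rabs (f e)) (Rabs_pos_lt _ N)) as (d & d0 & Hd).
  specialize (Hd (e + d / 2)). simpl in Hd. unfold R_dist, D_x, no_cond in Hd.
  rewrite (H (e + d / 2)) in Hd by lra.
  replace (0 - f e) with (- f e) in Hd by ring. rewrite Rabs_Ropp in Hd.
  apply (Rlt_irrefl (Rabs (f e))). apply Hd. split; [split; [trivial|lra]|].
  rewrite Rabs_right; lra.
Qed.

(** Comparison of first-order terms at [e]: the square [b x ^ 2] vanishes there to second order.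
    Dividing by [x - e] and using continuity avoids derivatives. *)
Lemma residue (b0 b1 b2 e : R) (h r : R -> R) :
  let b x := b0 + b1 * x + b2 * x ^ 2 in
  continuity_pt h e -> continuity_pt r e -> b e = 0 ->
  (forall x, b x ^ 2 - (x - e) * h x = (x - e) * r x) -> - h e = r e.
Proof.
  intros b Ch Cr Hb H.
  set (k := fun x => b x * (b1 + b2 * (x + e)) - h x - r x).
  assert (Z : k e = 0).
  { apply (continuous_root k).
    - unfold k, b. reg.
    - intros x Hx. unfold k.
      assert (E : b x = (x - e) * (b1 + b2 * (x + e))).
      { transitivity (b x - b e); [rewrite Hb; ring | unfold b; ring]. }
      apply (Rmult_eq_reg_l (x - e)); [|lra].
      specialize (H x). clearbody b.
      replace ((x - e) * (b x * (b1 + b2 * (x + e)) - h x - r x))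
        with (b x * ((x - e) * (b1 + b2 * (x + e))) - (x - e) * h x - (x - e) * r x)
        by ring.
      rewrite <- E. lra. }
  unfold k in Z. rewrite Hb in Z. lra.
Qed.

Lemma cubic_two_roots (p0 p1 p2 p3 u v : R) :
  let f x := p0 + p1 * x + p2 * x ^ 2 + p3 * x ^ 3 in
  u <> v -> f u = 0 -> f v = 0 ->
  forall x, f x = (x - u) * (x - v) * (p3 * x + (p2 + p3 * (u + v))).
Proof.
  intros f Huv Hu Hv x.
  (* This is the first divided difference of [f] at [u] and [v]. *)
  assert (S : p1 + p2 * (u + v) + p3 * (u ^ 2 + u * v + v ^ 2) = 0).
  { apply (Rmult_eq_reg_l (u - v)); [|lra]. unfold f in *.
    lra. }
  transitivity (f x - f u); [rewrite Hu; ring | unfold f].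
  replace p1 with (- (p2 * (u + v) + p3 * (u ^ 2 + u * v + v ^ 2))) by lra. ring.
Qed.

(* When [g u * B v = B u * g v], a combination of [g] and [B] is divisible by
   [(x - u) * (x - v)]; [K] is its square minus a multiple of [P], divided by
   that factor. *)
Lemma contact_quartic (u v r1 r2 r3 rho m1 m2 m3 B0 B1 B2 : R) :
  let g x := (x - m1) * (x - m2) * (x - m3) in
  let B x := B0 + B1 * x + B2 * x ^ 2 in
  let P x := (x - u) * (x - v) * ((x - r1) * (x - r2) * (x - r3)) in
  0 < rho -> u <> v -> g u <> 0 -> g u * B v - B u * g v = 0 ->
  exists k0 k1 k2 k3 k4 l0 l1 k,
    let K x := k0 + k1 * x + k2 * x ^ 2 + k3 * x ^ 3 + k4 * x ^ 4 in
    0 < k /\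
    (forall x, K x = (x - u) * (x - v) * (l0 + l1 * x) ^ 2
                     + k * ((x - r1) * (x - r2) * (x - r3))) /\
    (forall x, g x = 0 -> (x - u) * (x - v) * K x = g u ^ 2 * (B x ^ 2 + rho * P x)).
Proof.
  intros g B P Hr Huv Hg HF.
  (* The [q]'s are the coefficients of [L = g u * B - B u * g], which vanishes at [u] trivially and
     at [v] by hypothesis. At a root of [g] it reduces to [g u * B]. *)
  set (e1 := m1 + m2 + m3).
  set (e2 := m1 * m2 + m1 * m3 + m2 * m3).
  set (q3 := - B u). set (q2 := B u * e1 + g u * B2).
  set (q1 := - B u * e2 + g u * B1). set (q0 := B u * (m1 * m2 * m3) + g u * B0).
  set (L := fun x => q0 + q1 * x + q2 * x ^ 2 + q3 * x ^ 3).
  assert (HL : forall x, L x = - B u * g x + g u * B x).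
  { intros x. unfold L, q0, q1, q2, q3, e1, e2. generalize (g u), (B u).
    intros y z. unfold g, B. ring. }
  set (l1 := q3). set (l0 := q2 + q3 * (u + v)).
  assert (HF2 : forall x, L x = (x - u) * (x - v) * (l0 + l1 * x)).
  { intros x. rewrite (Rplus_comm l0).
    apply (cubic_two_roots q0 q1 q2 q3 u v Huv); fold (L u); fold (L v); rewrite HL; lra. }
  set (k := g u ^ 2 * rho).
  (* Coefficients of the quotient of [L ^ 2 + k * P] by [(x - u) * (x - v)], expanded. *)
  exists (u * v * l0 ^ 2 - k * (r1 * r2 * r3)),
    (- (u + v) * l0 ^ 2 + 2 * u * v * l1 * l0 + k * (r1 * r2 + r1 * r3 + r2 * r3)),
    (l0 ^ 2 - 2 * (u + v) * l1 * l0 + u * v * l1 ^ 2 - k * (r1 + r2 + r3)),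
    (2 * l1 * l0 - (u + v) * l1 ^ 2 + k), (l1 ^ 2), l0, l1, k.
  intros K.
  assert (HK : forall x, K x = (x - u) * (x - v) * (l0 + l1 * x) ^ 2
                     + k * ((x - r1) * (x - r2) * (x - r3))).
  { intros x. unfold K. clearbody l0 l1 k. ring. }
  split; [|split].
  - unfold k. apply Rmult_lt_0_compat; [|lra]. apply pow2_pos. exact Hg.
  - exact HK.
  - intros x Hx. rewrite HK.
    transitivity (L x ^ 2 + k * P x).
    + rewrite HF2. unfold P. clearbody l0 l1 k. ring.
    + rewrite HL, Hx. unfold k. ring.
Qed.

(** * Transversality in the two gaps *)

Section Gaps.
Context (c1 c2 c3 c4 c5 rho m1 m2 m3 B0 B1 B2 : R).
Let g x := (x - m1) * (x - m2) * (x - m3).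
Let B x := B0 + B1 * x + B2 * x ^ 2.
Let P x := (x - c1) * (x - c2) * (x - c3) * (x - c4) * (x - c5).
Context (h1 : m1 < c1) (h12 : c1 < c2) (h23 : c2 < c3) (h34 : c3 < c4) (h45 : c4 < c5).
Context (hm2 : c2 <= m2 <= c3) (hm3 : c4 <= m3 <= c5) (hrho : 0 < rho).
Context (H1 : B m1 ^ 2 + rho * P m1 <= 0).
Context (H2 : B m2 ^ 2 + rho * P m2 = 0) (H3 : B m3 ^ 2 + rho * P m3 = 0).

(** Otherwise the quartic [K] of [contact_quartic] exists. It vanishes at [m2] and [m3], is
    nonpositive at [m1], and at [c2], [c3] only its cubic term survives, which is positive. At [m1]
    an inequality suffices, which leaves room to shrink [B m1] in a reflection. *)
Lemma transversality_lower_gap :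
  g c2 <> 0 -> g c3 <> 0 -> g c2 * B c3 - B c2 * g c3 <> 0.
Proof.
  intros G2 G3 HF.
  assert (E2 : m2 <> c2) by (intros E; apply G2; unfold g; rewrite E; ring).
  assert (E3 : m2 <> c3) by (intros E; apply G3; unfold g; rewrite E; ring).
  destruct (contact_quartic c2 c3 c1 c4 c5 rho m1 m2 m3 B0 B1 B2 hrho
    ltac:(lra) G2 HF) as (k0 & k1 & k2 & k3 & k4 & l0 & l1 & k & Hk & HK & HE).
  fold (g c2) in HE.
  set (K := fun x => k0 + k1 * x + k2 * x ^ 2 + k3 * x ^ 3 + k4 * x ^ 4).
  assert (HE' : forall x, g x = 0 ->
    (x - c2) * (x - c3) * K x = g c2 ^ 2 * (B x ^ 2 + rho * P x)).
  { intros x Hx. unfold K. rewrite HE by exact Hx. unfold B, P. ring. }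
  (* The sixth point is any point beyond [c5], where both terms of [K] are nonnegative. *)
  apply (quartic_alternation k0 k1 k2 k3 k4 m1 c2 m2 c3 m3 (c5 + 1)); try lra.
  - apply Ropp_le_cancel. rewrite Ropp_0.
    apply (Rmult_pos_reg_le ((c2 - m1) * (c3 - m1))).
    { apply Rmult_lt_0_compat; lra. }
    fold (K m1). specialize (HE' m1 ltac:(unfold g; ring)).
    pose proof (Rmult_le_compat_l (g c2 ^ 2) _ _ (pow2_ge_0 _) H1). lra.
  - rewrite HK.
    pose proof (Rmult_lt_0_compat _ _ Hk (Rmult_lt_0_compat _ _ (Rmult_lt_0_compat
      (c2 - c1) (c4 - c2) ltac:(lra) ltac:(lra)) (ltac:(lra) : 0 < c5 - c2))). lra.
  - right. fold (K m2). apply (Rmult_eq_reg_l ((m2 - c2) * (m2 - c3))).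
    { rewrite HE', H2 by (unfold g; ring). ring. }
    apply Rmult_integral_contrapositive; split; lra.
  - rewrite HK.
    pose proof (Rmult_lt_0_compat _ _ Hk (Rmult_lt_0_compat _ _ (Rmult_lt_0_compat
      (c3 - c1) (c4 - c3) ltac:(lra) ltac:(lra)) (ltac:(lra) : 0 < c5 - c3))). lra.
  - right. fold (K m3). apply (Rmult_eq_reg_l ((m3 - c2) * (m3 - c3))).
    { rewrite HE', H3 by (unfold g; ring). ring. }
    apply Rmult_integral_contrapositive; split; lra.
  - rewrite HK.
    pose proof (Rmult_lt_0_compat _ _ Hk (Rmult_lt_0_compat _ _ (Rmult_lt_0_compat
      (c5 + 1 - c1) (c5 + 1 - c4) ltac:(lra) ltac:(lra)) (ltac:(lra) : 0 < c5 + 1 - c5))).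
    pose proof (Rmult_le_pos _ _ (Rmult_le_pos (c5 + 1 - c2) (c5 + 1 - c3) ltac:(lra)
      ltac:(lra)) (pow2_ge_0 (l0 + l1 * (c5 + 1)))). lra.
Qed.

Lemma transversality_upper_gap :
  g c5 <> 0 -> g c4 <> 0 -> g c5 * B c4 - B c5 * g c4 <> 0.
Proof.
  intros G5 G4 HF.
  assert (E4 : m3 <> c4) by (intros E; apply G4; unfold g; rewrite E; ring).
  assert (E5 : m3 <> c5) by (intros E; apply G5; unfold g; rewrite E; ring).
  destruct (contact_quartic c5 c4 c1 c2 c3 rho m1 m2 m3 B0 B1 B2 hrho
    ltac:(lra) G5 HF) as (k0 & k1 & k2 & k3 & k4 & l0 & l1 & k & Hk & HK & HE).
  fold (g c5) in HE.
  set (K := fun x => k0 + k1 * x + k2 * x ^ 2 + k3 * x ^ 3 + k4 * x ^ 4).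
  assert (HE' : forall x, g x = 0 ->
    (x - c5) * (x - c4) * K x = g c5 ^ 2 * (B x ^ 2 + rho * P x)).
  { intros x Hx. unfold K. rewrite HE by exact Hx. unfold B, P. ring. }
  (* At [c1] only the square term of [K] survives, at [c4] and [c5] only the cubic one. *)
  apply (quartic_alternation k0 k1 k2 k3 k4 m1 c1 m2 c4 m3 c5); try lra.
  - apply Ropp_le_cancel. rewrite Ropp_0.
    apply (Rmult_pos_reg_le ((c5 - m1) * (c4 - m1))).
    { apply Rmult_lt_0_compat; lra. }
    fold (K m1). specialize (HE' m1 ltac:(unfold g; ring)).
    pose proof (Rmult_le_compat_l (g c5 ^ 2) _ _ (pow2_ge_0 _) H1). lra.
  - rewrite HK.
    pose proof (Rmult_le_pos _ _ (Rmult_le_pos (c5 - c1) (c4 - c1) ltac:(lra)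
      ltac:(lra)) (pow2_ge_0 (l0 + l1 * c1))). lra.
  - right. fold (K m2). apply (Rmult_eq_reg_l ((m2 - c5) * (m2 - c4))).
    { rewrite HE', H2 by (unfold g; ring). ring. }
    apply Rmult_integral_contrapositive; split; lra.
  - rewrite HK.
    pose proof (Rmult_lt_0_compat _ _ Hk (Rmult_lt_0_compat _ _ (Rmult_lt_0_compat
      (c4 - c1) (c4 - c2) ltac:(lra) ltac:(lra)) (ltac:(lra) : 0 < c4 - c3))). lra.
  - right. fold (K m3). apply (Rmult_eq_reg_l ((m3 - c5) * (m3 - c4))).
    { rewrite HE', H3 by (unfold g; ring). ring. }
    apply Rmult_integral_contrapositive; split; lra.
  - rewrite HK.
    pose proof (Rmult_lt_0_compat _ _ Hk (Rmult_lt_0_compat _ _ (Rmult_lt_0_compat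
      (c5 - c1) (c5 - c2) ltac:(lra) ltac:(lra)) (ltac:(lra) : 0 < c5 - c3))). lra.
Qed.
End Gaps.

(** * Counting points on a broken line *)

(** The count on a single segment, half-open as in [points_on], so that a vertex is counted once, on
    the segment that it starts. *)
Definition unit_points (Y : R -> Prop) (e : nat) : Prop :=
  exists l : list R, NoDup l /\ length l = e /\ forall t, In t l <-> (0 <= t < 1 /\ Y t).

Lemma unit_points_ext (Y Z : R -> Prop) (e : nat) :
  (forall t, Y t <-> Z t) -> unit_points Y e -> unit_points Z e.
Proof.
  intros H (l & Nl & Ll & Hl). exists l. split; [exact Nl|split; [exact Ll|]].
  intros t. rewrite Hl, H. reflexivity.
Qed.

Lemma unit_points_one (Y : R -> Prop) (t0 : R) :
  (forall t, 0 <= t < 1 -> Y t <-> t = t0) -> 0 <= t0 < 1 -> unit_points Y 1.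
Proof.
  intros H H0. exists (t0 :: nil). split; [constructor; [simpl; tauto|constructor]|].
  split; [reflexivity|]. intros t. simpl. split.
  - intros [<-|[]]. split; [exact H0|]. apply H; auto.
  - intros [Ht HY]. left. symmetry. apply H; assumption.
Qed.

Lemma points_on_0 (p : nat -> pt) (X : pt -> Prop) : points_on p 0 X 0.
Proof.
  exists nil. split; [constructor|split; [reflexivity|]].
  intros k t. simpl. split; [tauto|lia].
Qed.

Lemma points_on_S (p : nat -> pt) (n m e : nat) (X : pt -> Prop) :
  points_on p n X m -> unit_points (fun t => X (seg p n t)) e ->
  points_on p (S n) X (m + e).
Proof.
  intros (l & Nl & Ll & Hl) (l' & Nl' & Ll' & Hl').
  exists (l ++ map (fun t => (n, t)) l')%list. split; [|split].
  - apply NoDup_app; [exact Nl| |].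
    + apply FinFun.Injective_map_NoDup; [|exact Nl']. intros x y [=]. assumption.
    + intros [k t] H1 H2. apply Hl in H1. apply in_map_iff in H2.
      destruct H2 as (s & [= <- _] & _). lia.
  - rewrite length_app, length_map. lia.
  - intros k t. rewrite in_app_iff, Hl, in_map_iff. split.
    + intros [(Hk & H)|(s & [= <- <-] & H)].
      * split; [lia|exact H].
      * apply Hl' in H. split; [lia|tauto].
    + intros (Hk & Ht & HX). destruct (Nat.eq_dec k n) as [->|Nk].
      * right. exists t. split; [reflexivity|]. apply Hl'. tauto.
      * left. split; [lia|tauto].
Qed.

Lemma points_on_unique (p : nat -> pt) (n m m' : nat) (X : pt -> Prop) :
  points_on p n X m -> points_on p n X m' -> m = m'.
Proof.
  intros (l & Nl & <- & Hl) (l' & Nl' & <- & Hl').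
  apply Nat.le_antisymm; apply NoDup_incl_length; try assumption;
    intros [k t] H; [apply Hl', Hl|apply Hl, Hl']; exact H.
Qed.

Lemma points_on_none (p : nat -> pt) (n k : nat) (t : R) (X : pt -> Prop) :
  points_on p n X 0 -> (k < n)%nat -> 0 <= t < 1 -> ~ X (seg p k t).
Proof.
  intros (l & _ & Ll & Hl) Hk Ht HX. apply length_zero_iff_nil in Ll. subst l.
  apply (proj2 (Hl k t)). tauto.
Qed.

Lemma points_on_uniform (p : nat -> pt) (X : pt -> Prop) (n : nat) :
  (forall k, unit_points (fun t => X (seg p k t)) 1) -> points_on p n X n.
Proof.
  intros H. induction n as [|n IH]; [apply points_on_0|].
  replace (S n) with (n + 1)%nat at 2 by lia. apply points_on_S; auto.
Qed.

(* Number of zeros on [0,1) of the affine function with values [x] at 0 and [y] at 1. *)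
Definition crossing (x y : R) : nat :=
  if Req_EM_T x 0 then 1%nat else if Rlt_dec (x * y) 0 then 1%nat else 0%nat.

Lemma affine_zeros (x y : R) : (x = 0 -> y <> 0) ->
  unit_points (fun t => x + t * (y - x) = 0) (crossing x y).
Proof.
  intros H. unfold crossing. destruct (Req_EM_T x 0) as [->|Nx].
  - apply (unit_points_one _ 0); [|lra]. intros t _. split; [|intros ->; ring].
    intros E. apply (Rmult_eq_reg_r y); [lra|auto].
  - destruct (Rlt_dec (x * y) 0) as [L|L].
    (* The zero is [x / (x - y)]; multiplying by the positive number [x * (x - y)] bounds it without
       splitting on the sign of [x]. *)
    + assert (D : 0 < x * (x - y)) by (pose proof (pow2_pos x Nx); lra).
      assert (D' : x - y <> 0) by (intros E; rewrite E in D; lra).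
      assert (F : x / (x - y) * (x * (x - y)) = x ^ 2) by (field; exact D').
      pose proof (pow2_pos x Nx).
      apply (unit_points_one _ (x / (x - y))).
      * intros t _. split; intros E.
        -- apply (Rmult_eq_reg_r (x - y)); [|exact D'].
           replace (x / (x - y) * (x - y)) with x by (field; exact D'). lra.
        -- rewrite E. field. exact D'.
      * split.
        -- apply (Rmult_le_reg_r (x * (x - y))); lra.
        -- apply (Rmult_lt_reg_r (x * (x - y))); lra.
    + exists nil. split; [constructor|split; [reflexivity|]]. intros t. split; [intros []|].
      intros [Ht E]. exfalso.
      assert (0 < x ^ 2 * (1 - t)) by (apply Rmult_lt_0_compat; [apply pow2_pos; auto|lra]).
      assert (0 <= t * (x * y)) by (apply Rmult_le_pos; lra).
      assert (x * (x + t * (y - x)) = 0) by (rewrite E; ring). lra.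
Qed.

(* [1] if the sign of [u * w] just before the present instant is positive, for a
   point [(u, w)] turning counterclockwise around the origin. *)
Definition quadrant (u w : R) : nat :=
  if Req_EM_T w 0 then 0%nat else if Req_EM_T u 0 then 1%nat
  else if Rlt_dec 0 (u * w) then 1%nat else 0%nat.

Ltac sign_cases x := destruct (Rtotal_order x 0) as [?|[?|?]]; [|subst x|].

Ltac decide_signs :=
  repeat (destruct (Req_EM_T _ _) || destruct (Rlt_dec _ _));
  try lra; try lia; exfalso; nra.

(** Turning counterclockwise, a zero of [u] leads from [u * w > 0] to [u * w < 0] and a zero of [w]
    leads back. So a zero of [u] lowers [quadrant] by one, a zero of [w] raises it by one, and the
    balance telescopes. *)
Lemma rotation_crossings (u w u' w' : R) : 0 < u * w' - u' * w ->
  (crossing u u' + quadrant u' w' = crossing w w' + quadrant u w)%nat.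
Proof.
  intros H. unfold crossing, quadrant.
  sign_cases u; sign_cases w; sign_cases u'; sign_cases w'; decide_signs.
Qed.

Lemma crossing_0 (x y : R) : crossing x y = 0%nat -> y <> 0 -> x <> 0 /\ 0 < x * y.
Proof.
  unfold crossing. destruct (Req_EM_T x 0); [discriminate|].
  destruct (Rlt_dec (x * y) 0); [discriminate|]. intros _ Hy. split; [assumption|].
  pose proof (Rmult_integral_contrapositive_currified x y).
  destruct (Rtotal_order (x * y) 0) as [|[|]]; tauto.
Qed.

(** With no axis crossed, the point stays in one open quadrant. There [u ^ 2 / w ^ 2], the squared
    cotangent of its angle, is monotone, decreasing where [u * w > 0] and increasing where
    [u * w < 0]. *)
Lemma rotation_ratio (u w u' w' : R) : 0 < u * w' - u' * w ->
  crossing u u' = 0%nat -> crossing w w' = 0%nat -> u' <> 0 -> w' <> 0 ->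
  (quadrant u w = 1%nat /\ u' ^ 2 / w' ^ 2 < u ^ 2 / w ^ 2) \/
  (quadrant u w = 0%nat /\ u ^ 2 / w ^ 2 < u' ^ 2 / w' ^ 2).
Proof.
  intros H Hu Hw Nu' Nw'.
  destruct (crossing_0 _ _ Hu Nu') as [Nu Pu].
  destruct (crossing_0 _ _ Hw Nw') as [Nw Pw].
  pose proof (pow2_pos w Nw) as W2. pose proof (pow2_pos w' Nw') as W2'.
  assert (Quot : forall x y, x * w' ^ 2 < y * w ^ 2 -> x / w ^ 2 < y / w' ^ 2).
  { intros x y E. apply (Rmult_lt_reg_r (w ^ 2 * w' ^ 2));
      [apply Rmult_lt_0_compat; assumption|].
    replace (x / w ^ 2 * (w ^ 2 * w' ^ 2)) with (x * w' ^ 2) by (field; exact Nw).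
    replace (y / w' ^ 2 * (w ^ 2 * w' ^ 2)) with (y * w ^ 2) by (field; exact Nw').
    exact E. }
  assert (Quot' : forall x y, x * w ^ 2 < y * w' ^ 2 -> x / w' ^ 2 < y / w ^ 2).
  { intros x y E. apply (Rmult_lt_reg_r (w ^ 2 * w' ^ 2));
      [apply Rmult_lt_0_compat; assumption|].
    replace (x / w' ^ 2 * (w ^ 2 * w' ^ 2)) with (x * w ^ 2) by (field; exact Nw').
    replace (y / w ^ 2 * (w ^ 2 * w' ^ 2)) with (y * w' ^ 2) by (field; exact Nw).
    exact E. }
  unfold quadrant. destruct (Req_EM_T w 0); [contradiction|].
  destruct (Req_EM_T u 0); [contradiction|].
  destruct (Rlt_dec 0 (u * w)) as [P|P]; [left|right]; (split; [reflexivity|]).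
  - apply Quot'.
    assert (0 < u * w') by (apply (Rmult_lt_reg_l (w ^ 2)); [exact W2|];
      pose proof (Rmult_lt_0_compat _ _ P Pw); lra).
    assert (0 < u' * w) by (apply (Rmult_lt_reg_l (u ^ 2)); [apply pow2_pos; exact Nu|];
      pose proof (Rmult_lt_0_compat _ _ P Pu); lra).
    pose proof (Rmult_lt_0_compat _ _ H (Rplus_lt_0_compat _ _ H0 H1)). lra.
  - apply Quot.
    assert (Q : 0 < - (u * w)).
    { pose proof (Rmult_integral_contrapositive_currified u w Nu Nw).
      destruct (Rtotal_order (u * w) 0) as [|[|]]; lra. }
    assert (0 < - (u * w')) by (apply (Rmult_lt_reg_l (w ^ 2)); [exact W2|];
      pose proof (Rmult_lt_0_compat _ _ Q Pw); lra).
    assert (0 < - (u' * w)) by (apply (Rmult_lt_reg_l (u ^ 2)); [apply pow2_pos; exact Nu|];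
      pose proof (Rmult_lt_0_compat _ _ Q Pu); lra).
    pose proof (Rmult_lt_0_compat _ _ H (Rplus_lt_0_compat _ _ H0 H1)). lra.
Qed.

(** A nonnegative quadratic with zero discriminant is the square of [u0 + t * u1]. When [G = 0], the
    sign of [D] comes from the value at [t = 1]. *)
Lemma affine_square_root (G B D : R) : B ^ 2 = G * D ->
  (forall t, 0 <= G + 2 * t * B + t ^ 2 * D) ->
  exists u0 u1, G = u0 ^ 2 /\ B = u0 * u1 /\ D = u1 ^ 2.
Proof.
  intros E H.
  assert (HG : 0 <= G) by (specialize (H 0); lra).
  destruct (Req_dec G 0) as [Z|Z].
  - assert (B = 0) by (apply Rsqr_0_uniq; unfold Rsqr; rewrite Z in E; lra).
    assert (HD : 0 <= D) by (specialize (H 1); lra).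
    exists 0, (sqrt D). rewrite pow2_sqrt by assumption. lra.
  - assert (S : sqrt G ^ 2 = G) by (apply pow2_sqrt; exact HG).
    assert (N : sqrt G <> 0) by (intros F; rewrite F in S; lra).
    exists (sqrt G), (B / sqrt G). split; [lra|split].
    + field. exact N.
    + unfold Rdiv. rewrite Rpow_mult_distr, pow_inv, S, E. field. exact Z.
Qed.

(* Sign of a coordinate just before the instant where it has value [x] and speed [v]. *)
Definition side (x v : R) : nat :=
  if Req_EM_T x 0 then (if Rlt_dec v 0 then 1%nat else 0%nat)
  else if Rlt_dec 0 x then 1%nat else 0%nat.

(** There is a zero on [[0,1)] exactly when the sides just before the times 0 and 1 differ. *)
Lemma side_crossing (x y : R) : (x = 0 -> y <> 0) -> exists j,
  (crossing x y + side x (y - x) + side y (y - x) = 2 * j)%nat.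
Proof.
  intros H. unfold crossing, side.
  sign_cases x; sign_cases y; try (exfalso; apply H; reflexivity);
    repeat (destruct (Req_EM_T _ _) || destruct (Rlt_dec _ _));
    try lra; try (exfalso; nra);
    try (exists 0%nat; reflexivity); exists 1%nat; reflexivity.
Qed.

(** Every zero of [f] switches the side, a reflection at a vertex keeps it, and after a period the
    side is back to its first value. *)
Lemma even_crossings (p : nat -> pt) (n : nat) (f : pt -> R) :
  let V k := psub (p (S k)) (p k) in
  (forall k t, f (seg p k t) = f (p k) + t * f (V k)) ->
  (forall k, f (V k) = f (p (S k)) - f (p k)) ->
  (forall k, f (p k) = 0 -> f (V k) <> 0) ->
  (forall k, f (p (S k)) = 0 -> 0 < f (V k) * f (V (S k))) ->
  p n = p 0%nat -> p (S n) = p 1%nat ->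
  exists j, points_on p n (fun X => f X = 0) (2 * j).
Proof.
  intros V Hseg HV H0 Hrefl Pn PSn.
  set (s := fun k => side (f (p k)) (f (V k))).
  assert (I : forall m, exists e j, points_on p m (fun X => f X = 0) e /\
    (e + s 0%nat + s m = 2 * j)%nat).
  { induction m as [|m (e & j & He & Hj)].
    - exists 0%nat, (s 0%nat). split; [apply points_on_0|lia].
    - assert (Hm : f (p m) = 0 -> f (p (S m)) <> 0).
      { intros E. pose proof (H0 m E) as F. rewrite HV in F. lra. }
      destruct (side_crossing _ _ Hm) as (j' & Hj').
      (* Adding the two even sums counts [s m] twice; hence the correction. *)
      exists (e + crossing (f (p m)) (f (p (S m))))%nat, (j + j' - s m)%nat. split.
      + apply points_on_S; [exact He|].
        apply unit_points_ext with (2 := affine_zeros _ _ Hm).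
        intros t. rewrite Hseg, HV. reflexivity.
      + rewrite <- HV in Hj'. fold (s m) in Hj'.
        replace (side (f (p (S m))) (f (V m))) with (s (S m)) in Hj'; [lia|].
        unfold s, side. destruct (Req_EM_T (f (p (S m))) 0) as [E|]; [|reflexivity].
        pose proof (Hrefl m E) as P.
        destruct (Rlt_dec (f (V (S m))) 0), (Rlt_dec (f (V m)) 0); try reflexivity;
          exfalso; nra. }
  destruct (I n) as (e & j & He & Hj).
  exists (j - s 0%nat)%nat. replace (2 * (j - s 0%nat))%nat with e; [exact He|].
  assert (s n = s 0%nat) by (unfold s, V; rewrite Pn, PSn; reflexivity). lia.
Qed.

(** * Elliptic coordinates along a line with given caustics *)

(* [bil U V l] is [ux vx/(a-l) + uy vy/(b-l) + uz vz/(c-l)] multiplied by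
   [(a-l)(b-l)(c-l)], which makes sense for [l] in [{a,b,c}] as well: there
   [gam X l] is a nonzero multiple of the square of a coordinate of [X]. *)
Definition bil (a b c : R) (U V : pt) (l : R) : R :=
  px U * px V * ((b - l) * (c - l)) + py U * py V * ((a - l) * (c - l))
  + pz U * pz V * ((a - l) * (b - l)).

Definition gam (a b c : R) (X : pt) (l : R) : R :=
  bil a b c X X l - (a - l) * (b - l) * (c - l).

Definition quint (c1 c2 c3 c4 c5 x : R) : R :=
  (x - c1) * (x - c2) * (x - c3) * (x - c4) * (x - c5).

Lemma bil_quadratic (a b c : R) (U V : pt) :
  exists B0 B1 B2, forall l, bil a b c U V l = B0 + B1 * l + B2 * l ^ 2.
Proof.
  exists (px U * px V * (b * c) + py U * py V * (a * c) + pz U * pz V * (a * b)),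
    (- (px U * px V * (b + c) + py U * py V * (a + c) + pz U * pz V * (a + b))),
    (px U * px V + py U * py V + pz U * pz V).
  intros l. unfold bil. ring.
Qed.

Lemma quint_nonpos (c1 c2 c3 c4 c5 x : R) :
  c1 < c2 -> c2 < c3 -> c3 < c4 -> c4 < c5 -> quint c1 c2 c3 c4 c5 x <= 0 ->
  x <= c1 \/ c2 <= x <= c3 \/ c4 <= x <= c5.
Proof.
  intros h1 h2 h3 h4 H. unfold quint in H.
  destruct (Rle_dec x c1); [lra|].
  destruct (Rle_dec c2 x); [destruct (Rle_dec x c3); [lra|]|].
  - destruct (Rle_dec c4 x); [destruct (Rle_dec x c5); [lra|]|]; exfalso.
    + assert (0 < (x - c1) * (x - c2) * (x - c3) * (x - c4) * (x - c5)); [|lra].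
      repeat apply Rmult_lt_0_compat; lra.
    + assert (0 < (x - c1) * (x - c2) * (x - c3) * (c4 - x) * (c5 - x)); [|lra].
      repeat apply Rmult_lt_0_compat; lra.
  - exfalso.
    assert (0 < (x - c1) * (c2 - x) * (c3 - x) * (c4 - x) * (c5 - x)); [|lra].
    repeat apply Rmult_lt_0_compat; lra.
Qed.

(** Up to a constant factor, the left side is the discriminant of [t] mapped to [gam (X + tV) x].
    The identity treats tangency to a caustic and crossing of a coordinate plane alike. *)
Definition caustic_line (a b c c1 c2 c3 c4 c5 : R) (X V : pt) : Prop :=
  0 < dot V V /\
  forall x, bil a b c X V x ^ 2 - gam a b c X x * bil a b c V V x
            = - (dot V V * quint c1 c2 c3 c4 c5 x).

Section Frame.
Context (a b c c1 c2 c3 c4 c5 : R).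
Context (h01 : 0 < c1) (h12 : c1 < c2) (h23 : c2 < c3) (h34 : c3 < c4) (h45 : c4 < c5).
Context (hc : c = c1 \/ c = c2) (hb : b = c3 \/ b = c4) (ha : a = c5).

Local Notation g := (gam a b c).
Local Notation B := (bil a b c).
Local Notation line := (caustic_line a b c c1 c2 c3 c4 c5).

(** At a common root [e] of [gam X] and [quint], the caustic identity makes [bil X V] vanish too, so
    its square does not contribute to first order. *)
Lemma line_residue (X V : pt) (e m m' : R) (q : R -> R) :
  line X V -> continuity_pt q e ->
  (forall x, g X x = (x - e) * ((x - m) * (x - m'))) ->
  (forall x, quint c1 c2 c3 c4 c5 x = (x - e) * q x) ->
  (e - m) * (e - m') * B V V e = dot V V * q e.
Proof.
  intros [HV HL] Cq Hg Hq.
  destruct (bil_quadratic a b c X V) as (B0 & B1 & B2 & HB).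
  destruct (bil_quadratic a b c V V) as (D0 & D1 & D2 & HD).
  rewrite HD.
  pose (h := fun x => (x - m) * (x - m') * (D0 + D1 * x + D2 * x ^ 2)).
  pose (r := fun x => - (dot V V * q x)).
  pose proof (residue B0 B1 B2 e h r) as E. unfold h, r in E.
  enough (- ((e - m) * (e - m') * (D0 + D1 * e + D2 * e ^ 2)) = - (dot V V * q e)) by lra.
  apply E.
  - reg.
  - reg.
  - specialize (HL e). rewrite Hg, Hq, HB in HL.
    apply Rsqr_0_uniq. unfold Rsqr. lra.
  - intros x. specialize (HL x). rewrite Hg, Hq, HB, HD in HL. lra.
Qed.

(** At [c], [b], [a] only one square survives in [gam X], so its signs interlace the roots with
    these numbers. At a root the caustic identity gives [quint <= 0], which puts it in one of the
    three bands. Together these determine the band of each root, up to coincidences at [c] and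
    [b]. *)
Lemma line_elliptic (X V : pt) : line X V ->
  exists m1 m2 m3, m1 <= c1 /\ c2 <= m2 <= c3 /\ c4 <= m3 <= c5 /\
    forall x, g X x = (x - m1) * (x - m2) * (x - m3).
Proof.
  intros HX.
  assert (hcb : c < b) by lra. assert (hba : b < a) by lra.
  assert (S : forall x y, 0 <= x -> 0 <= y -> 0 <= x ^ 2 * y).
  { intros. apply Rmult_le_pos; [apply pow2_ge_0|assumption]. }
  destruct (cubic_interlacing
    (px X ^ 2 + py X ^ 2 + pz X ^ 2 - (a + b + c))
    (a * b + a * c + b * c - px X ^ 2 * (b + c) - py X ^ 2 * (a + c) - pz X ^ 2 * (a + b))
    (px X ^ 2 * (b * c) + py X ^ 2 * (a * c) + pz X ^ 2 * (a * b) - a * b * c)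
    a b c hcb hba) as (m1 & m2 & m3 & h1 & h2 & h3 & Hf).
  { pose proof (Rmult_le_pos _ _ (pow2_ge_0 (pz X))
      (Rmult_le_pos (a - c) (b - c) ltac:(lra) ltac:(lra))). lra. }
  { pose proof (Rmult_le_pos _ _ (pow2_ge_0 (py X))
      (Rmult_le_pos (a - b) (b - c) ltac:(lra) ltac:(lra))). lra. }
  { pose proof (Rmult_le_pos _ _ (pow2_ge_0 (px X))
      (Rmult_le_pos (a - b) (a - c) ltac:(lra) ltac:(lra))). lra. }
  assert (Hg : forall x, g X x = (x - m1) * (x - m2) * (x - m3)).
  { intros x. rewrite <- Hf. unfold gam, bil. ring. }
  destruct HX as [HV HL].
  assert (HR : forall m, g X m = 0 -> m <= c1 \/ c2 <= m <= c3 \/ c4 <= m <= c5).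
  { intros m Hm. apply quint_nonpos; try assumption.
    specialize (HL m). rewrite Hm in HL. pose proof (pow2_ge_0 (B X V m)).
    apply Ropp_le_cancel. rewrite Ropp_0.
    apply (Rmult_pos_reg_le (dot V V)); lra. }
  assert (Dc : 0 <= B V V c).
  { pose proof (Rmult_le_pos _ _ (pow2_ge_0 (pz V))
      (Rmult_le_pos (a - c) (b - c) ltac:(lra) ltac:(lra))). unfold bil. lra. }
  assert (Db : B V V b <= 0).
  { pose proof (Rmult_le_pos _ _ (pow2_ge_0 (py V))
      (Rmult_le_pos (a - b) (b - c) ltac:(lra) ltac:(lra))). unfold bil. lra. }
  pose proof (HR m1 ltac:(rewrite Hg; ring)) as R1.
  pose proof (HR m2 ltac:(rewrite Hg; ring)) as R2.
  pose proof (HR m3 ltac:(rewrite Hg; ring)) as R3.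
  (* [N1] to [N4] exclude a root at [c] or [b] that is an endpoint of the wrong band: the two sides
     of [line_residue] would have incompatible signs. *)
  assert (N1 : ~ (m1 = c /\ c = c2)).
  { intros [-> E].
    pose proof (line_residue X V c m2 m3
      (fun x => (x - c1) * (x - c3) * (x - c4) * (x - c5)) (conj HV HL)) as H.
    specialize (H ltac:(reg) ltac:(intros; rewrite Hg; ring)
      ltac:(intros; unfold quint; rewrite E; ring)). simpl in H.
    assert (0 < dot V V * ((c - c1) * (c3 - c) * (c4 - c) * (c5 - c))).
    { repeat apply Rmult_lt_0_compat; lra. }
    pose proof (Rmult_le_pos _ _ (Rmult_le_pos (m2 - c) (m3 - c) ltac:(lra) ltac:(lra)) Dc).
    lra. }
  assert (N2 : ~ (m2 = c /\ c = c1)).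
  { intros [-> E].
    pose proof (line_residue X V c m1 m3
      (fun x => (x - c2) * (x - c3) * (x - c4) * (x - c5)) (conj HV HL)) as H.
    specialize (H ltac:(reg) ltac:(intros; rewrite Hg; ring)
      ltac:(intros; unfold quint; rewrite E; ring)). simpl in H.
    assert (0 < dot V V * ((c2 - c) * (c3 - c) * (c4 - c) * (c5 - c))).
    { repeat apply Rmult_lt_0_compat; lra. }
    pose proof (Rmult_le_pos _ _ (Rmult_le_pos (c - m1) (m3 - c) ltac:(lra) ltac:(lra)) Dc).
    lra. }
  assert (N3 : ~ (m2 = b /\ b = c4)).
  { intros [-> E].
    pose proof (line_residue X V b m1 m3
      (fun x => (x - c1) * (x - c2) * (x - c3) * (x - c5)) (conj HV HL)) as H.
    specialize (H ltac:(reg) ltac:(intros; rewrite Hg; ring)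
      ltac:(intros; unfold quint; rewrite E; ring)). simpl in H.
    assert (0 < dot V V * ((b - c1) * (b - c2) * (b - c3) * (c5 - b))).
    { repeat apply Rmult_lt_0_compat; lra. }
    pose proof (Rmult_le_pos _ (- B V V b)
      (Rmult_le_pos (b - m1) (m3 - b) ltac:(lra) ltac:(lra)) ltac:(lra)).
    lra. }
  assert (N4 : ~ (m3 = b /\ b = c3)).
  { intros [-> E].
    pose proof (line_residue X V b m1 m2
      (fun x => (x - c1) * (x - c2) * (x - c4) * (x - c5)) (conj HV HL)) as H.
    specialize (H ltac:(reg) ltac:(intros; rewrite Hg; ring)
      ltac:(intros; unfold quint; rewrite E; ring)). simpl in H.
    assert (0 < dot V V * ((b - c1) * (b - c2) * (c4 - b) * (c5 - b))).
    { repeat apply Rmult_lt_0_compat; lra. }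
    pose proof (Rmult_le_pos _ (- B V V b)
      (Rmult_le_pos (b - m1) (b - m2) ltac:(lra) ltac:(lra)) ltac:(lra)).
    lra. }
  clear - h12 h23 h34 h45 hc hb ha h1 h2 h3 R1 R2 R3 N1 N2 N3 N4 Hg.
  exists m1, m2, m3. repeat apply conj; try exact Hg.
  - destruct R1 as [|[|]]; [lra| |lra]. exfalso. apply N1. lra.
  - destruct R2 as [|[|]]; [|lra|lra]. exfalso. apply N2. lra.
  - destruct R2 as [|[|]]; [lra|lra|]. exfalso. apply N3. lra.
  - destruct R3 as [|[|]]; [lra| |lra]. exfalso. apply N4. lra.
  - lra.
Qed.

Lemma quint_simple_root (e : R) : quint c1 c2 c3 c4 c5 e = 0 ->
  exists q, continuity_pt q e /\
    (forall x, quint c1 c2 c3 c4 c5 x = (x - e) * q x) /\ q e <> 0.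
Proof.
  intros H. unfold quint in H |- *.
  repeat (apply Rmult_integral in H; destruct H as [H|H]);
    apply Rminus_diag_uniq in H; subst e.
  - exists (fun x => (x - c2) * (x - c3) * (x - c4) * (x - c5)).
    split; [reg|split; [intros; ring|]].
    repeat apply Rmult_integral_contrapositive_currified; lra.
  - exists (fun x => (x - c1) * (x - c3) * (x - c4) * (x - c5)).
    split; [reg|split; [intros; ring|]].
    repeat apply Rmult_integral_contrapositive_currified; lra.
  - exists (fun x => (x - c1) * (x - c2) * (x - c4) * (x - c5)).
    split; [reg|split; [intros; ring|]].
    repeat apply Rmult_integral_contrapositive_currified; lra.
  - exists (fun x => (x - c1) * (x - c2) * (x - c3) * (x - c5)).
    split; [reg|split; [intros; ring|]].
    repeat apply Rmult_integral_contrapositive_currified; lra.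
  - exists (fun x => (x - c1) * (x - c2) * (x - c3) * (x - c4)).
    split; [reg|split; [intros; ring|]].
    repeat apply Rmult_integral_contrapositive_currified; lra.
Qed.

(** The roots of [quint] are simple, so the right side of [line_residue] is nonzero. Hence the
    affine function whose signed square is [gam] at [e] has nonzero slope wherever it vanishes. *)
Lemma line_direction_nonzero (X V : pt) (e : R) :
  line X V -> quint c1 c2 c3 c4 c5 e = 0 -> g X e = 0 -> B V V e <> 0.
Proof.
  intros HX He H0 HB. pose proof (proj1 HX) as HV.
  destruct (line_elliptic X V HX) as (m1 & m2 & m3 & _ & _ & _ & Hg).
  destruct (quint_simple_root e He) as (q & Cq & Hq & Nq).
  assert (exists m m', forall x, g X x = (x - e) * ((x - m) * (x - m'))) as (m & m' & Hm).
  { rewrite Hg in H0.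
    repeat (apply Rmult_integral in H0; destruct H0 as [H0|H0]);
      apply Rminus_diag_uniq in H0; subst e.
    - exists m2, m3. intros. rewrite Hg. ring.
    - exists m1, m3. intros. rewrite Hg. ring.
    - exists m1, m2. intros. rewrite Hg. ring. }
  pose proof (line_residue X V e m m' q HX Cq Hm Hq) as E.
  rewrite HB, Rmult_0_r in E. symmetry in E. apply Rmult_integral in E.
  destruct E; [lra|auto].
Qed.

Lemma line_signs (X V : pt) : line X V ->
  0 <= g X c2 /\ g X c3 <= 0 /\ g X c4 <= 0 /\ 0 <= g X c5 /\
  (g X c2 <> 0 \/ g X c3 <> 0) /\ (g X c5 <> 0 \/ g X c4 <> 0).
Proof.
  intros HX.
  destruct (line_elliptic X V HX) as (m1 & m2 & m3 & M1 & M2 & M3 & Hg).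
  rewrite !Hg.
  assert (T : forall x y z, 0 <= x -> 0 <= y -> 0 <= z -> 0 <= x * y * z).
  { intros. repeat apply Rmult_le_pos; assumption. }
  assert (Z : forall x y z, x <> 0 -> y <> 0 -> z <> 0 -> x * y * z <> 0).
  { intros. repeat apply Rmult_integral_contrapositive_currified; assumption. }
  repeat split.
  - pose proof (T (c2 - m1) (m2 - c2) (m3 - c2)). lra.
  - pose proof (T (c3 - m1) (c3 - m2) (m3 - c3)). lra.
  - pose proof (T (c4 - m1) (c4 - m2) (m3 - c4)). lra.
  - pose proof (T (c5 - m1) (c5 - m2) (c5 - m3)). lra.
  - destruct (Req_dec m2 c2); [right|left]; apply Z; lra.
  - destruct (Req_dec m3 c4); [left|right]; apply Z; lra.
Qed.

Lemma line_impact (X V : pt) : line X V -> g X 0 = 0 ->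
  exists m2 m3, c2 <= m2 <= c3 /\ c4 <= m3 <= c5 /\
    forall x, g X x = (x - 0) * (x - m2) * (x - m3).
Proof.
  intros HX H0.
  destruct (line_elliptic X V HX) as (m1 & m2 & m3 & M1 & M2 & M3 & Hg).
  exists m2, m3. split; [exact M2|split; [exact M3|]].
  rewrite Hg in H0.
  assert (m1 = 0) as ->; [|exact Hg].
  repeat (apply Rmult_integral in H0; destruct H0 as [H0|H0]); lra.
Qed.

(** * Reflection *)

(** The second pair is reversed so that in both cases [gam] is nonnegative at [u] and nonpositive at
    [v]. *)
Definition gap (u v : R) : Prop := (u = c2 /\ v = c3) \/ (u = c5 /\ v = c4).

(** If [gam] at [u] and [v] is [x ^ 2] and [- y ^ 2] for affine [x], [y] with slopes [x1], [y1],
    this is [- (x * y) * (x * y1 - x1 * y)]. It sees the sense of rotation and the quadrant without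
    a choice of square roots. *)
Definition phi (u v : R) (X V : pt) : R := g X u * B X V v - B X V u * g X v.

(** On [Q] the least elliptic coordinate is 0. The vector [W] may differ from [V] only in the
    corresponding component, shrunk in absolute value: [W = V] serves on a chord, the other vectors
    in a reflection. *)
Lemma phi_neq_0 (X V W : pt) (u v : R) : line X V -> g X 0 = 0 -> gap u v ->
  (forall m, m <> 0 -> g X m = 0 -> B X W m = B X V m) ->
  B X W 0 ^ 2 <= B X V 0 ^ 2 ->
  g X u <> 0 -> g X v <> 0 -> phi u v X W <> 0.
Proof.
  intros HX H0 Huv Hm HW0 Hu Hv.
  destruct (line_impact X V HX H0) as (m2 & m3 & M2 & M3 & Hg).
  destruct HX as [HV HL].
  destruct (bil_quadratic a b c X W) as (B0 & B1 & B2 & HB).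
  assert (G2 : g X m2 = 0) by (rewrite Hg; ring).
  assert (G3 : g X m3 = 0) by (rewrite Hg; ring).
  assert (E1 : (B0 + B1 * 0 + B2 * 0 ^ 2) ^ 2
     + dot V V * quint c1 c2 c3 c4 c5 0 <= 0).
  { specialize (HL 0). rewrite H0 in HL. rewrite <- HB. lra. }
  assert (E2 : (B0 + B1 * m2 + B2 * m2 ^ 2) ^ 2
     + dot V V * quint c1 c2 c3 c4 c5 m2 = 0).
  { specialize (HL m2). rewrite G2 in HL. rewrite <- HB, Hm by (assumption || lra). lra. }
  assert (E3 : (B0 + B1 * m3 + B2 * m3 ^ 2) ^ 2
     + dot V V * quint c1 c2 c3 c4 c5 m3 = 0).
  { specialize (HL m3). rewrite G3 in HL. rewrite <- HB, Hm by (assumption || lra). lra. }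
  unfold phi. rewrite !HB. rewrite !Hg. rewrite Hg in Hu, Hv.
  destruct Huv as [[-> ->]|[-> ->]].
  - apply (transversality_lower_gap c1 c2 c3 c4 c5 (dot V V)); assumption.
  - apply (transversality_upper_gap c1 c2 c3 c4 c5 (dot V V)); assumption.
Qed.

(** Confocal quadrics meet orthogonally: at a nonzero root [l] of [gam X], the normal of [Q] is
    [bil]-orthogonal to [X], so adding a multiple of it to a velocity does not change
    [bil X _ l]. *)
Lemma normal_polar (X : pt) (l : R) : onQ a b c X ->
  l * B X (normalQ a b c X) l = g X l.
Proof.
  intros H. unfold onQ in H. unfold gam, bil, normalQ. simpl.
  transitivity ((px X ^ 2 / a + py X ^ 2 / b + pz X ^ 2 / c) * - ((a - l) * (b - l) * (c - l))
    + (px X * px X * ((b - l) * (c - l)) + py X * py X * ((a - l) * (c - l))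
    + pz X * pz X * ((a - l) * (b - l)))).
  - field. lra.
  - rewrite H. ring.
Qed.

Lemma bil_at_0 (X V : pt) : B X V 0 = a * b * c * dot V (normalQ a b c X).
Proof. unfold bil, dot, normalQ. simpl. field. lra. Qed.

Lemma bil_reflected (X U N : pt) (s l : R) :
  B X (psub U (pscale s N)) l = B X U l - s * B X N l.
Proof. unfold bil, psub, pscale. simpl. ring. Qed.

Lemma onQ_gam (X : pt) : onQ a b c X <-> g X 0 = 0.
Proof.
  assert (E : g X 0 = a * b * c * (px X ^ 2 / a + py X ^ 2 / b + pz X ^ 2 / c - 1)).
  { unfold gam, bil. field. lra. }
  assert (P : a * b * c <> 0).
  { repeat apply Rmult_integral_contrapositive_currified; lra. }
  unfold onQ. rewrite E. split; intros H.
  - rewrite H. ring.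
  - apply Rmult_integral in H. destruct H; [contradiction|lra].
Qed.

(* Deform the normal component of the velocity affinely to its opposite: the
   other elliptic components are kept, so [phi] never vanishes on the way. *)
Lemma phi_reflection (X U : pt) (u v : R) :
  let N := normalQ a b c X in
  let W := psub U (pscale (2 * dot U N / dot N N) N) in
  onQ a b c X -> line X U -> gap u v -> g X u <> 0 -> g X v <> 0 ->
  0 < phi u v X U * phi u v X W.
Proof.
  intros N W HQ HX Huv Hu Hv.
  assert (H0 : g X 0 = 0) by (apply onQ_gam; exact HQ).
  destruct (line_impact X U HX H0) as (m2 & m3 & M2 & M3 & Hg).
  set (k := 2 * dot U N / dot N N) in W.
  assert (HN : dot N N <> 0).
  { intros E.
    assert (Z : px X / a = 0 /\ py X / b = 0 /\ pz X / c = 0).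
    { unfold dot, N, normalQ in E. simpl in E.
      pose proof (pow2_ge_0 (px X / a)). pose proof (pow2_ge_0 (py X / b)).
      pose proof (pow2_ge_0 (pz X / c)).
      repeat split; apply Rsqr_0_uniq; unfold Rsqr; lra. }
    destruct Z as (Zx & Zy & Zz). unfold onQ in HQ.
    replace (px X ^ 2 / a) with (px X * (px X / a)) in HQ by (field; lra).
    replace (py X ^ 2 / b) with (py X * (py X / b)) in HQ by (field; lra).
    replace (pz X ^ 2 / c) with (pz X * (pz X / c)) in HQ by (field; lra).
    rewrite Zx, Zy, Zz in HQ. lra. }
  (* The parameter [s] leads from [U] at 0 to [W] at 1 and multiplies the normal component by
     [1 - 2 * s]. *)
  assert (NZ : forall s, 0 <= s <= 1 -> phi u v X (psub U (pscale (s * k) N)) <> 0).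
  { intros s Hs. apply (phi_neq_0 X U); try assumption.
    - intros m Nm Hm. rewrite bil_reflected.
      pose proof (normal_polar X m HQ) as E. rewrite Hm in E. fold N in E.
      apply Rmult_integral in E. destruct E as [E|E]; [contradiction|].
      rewrite E. ring.
    - rewrite bil_reflected, !bil_at_0. fold N.
      replace (a * b * c * dot U N - s * k * (a * b * c * dot N N))
        with ((1 - 2 * s) * (a * b * c * dot U N)) by (unfold k; field; exact HN).
      generalize (a * b * c * dot U N). intros y.
      pose proof (Rmult_le_pos _ _ (pow2_ge_0 y)
        (Rmult_le_pos s (1 - s) ltac:(lra) ltac:(lra))). lra. }
  assert (Lin : forall s, phi u v X (psub U (pscale (s * k) N))
      = phi u v X U + s * (phi u v X W - phi u v X U)).
  { intros s. unfold W, phi. rewrite !bil_reflected. ring. }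
  assert (N0 : phi u v X U <> 0).
  { pose proof (NZ 0 ltac:(lra)) as E. rewrite Lin in E. intros F. apply E. rewrite F. ring. }
  assert (N1 : phi u v X W <> 0).
  { pose proof (NZ 1 ltac:(lra)) as E. rewrite Lin in E. intros F. apply E. rewrite F. ring. }
  set (y := phi u v X U) in *. set (z := phi u v X W) in *. clearbody y z.
  (* For [y <> z], the affine function from [y] to [z] vanishes at [y / (y - z)], which lies in
     [[0,1]] when the signs are opposite. *)
  assert (NZ' : 0 <= y / (y - z) <= 1 -> y = z).
  { intros H. destruct (Req_dec y z) as [|Nyz]; [assumption|exfalso].
    apply (NZ _ H). rewrite Lin. field. lra. }
  destruct (Rlt_dec 0 (y * z)) as [|Hyz]; [assumption|exfalso].
  assert (y < 0 < z \/ z < 0 < y) as [S|S].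
  { destruct (Rdichotomy y 0 N0), (Rdichotomy z 0 N1); try lra; exfalso; apply Hyz.
    - pose proof (Rmult_lt_0_compat (- y) (- z)). lra.
    - apply Rmult_lt_0_compat; lra. }
  - enough (y = z) by lra. apply NZ'.
    replace (y / (y - z)) with ((- y) / (z - y)) by (field; lra).
    split; [apply Rmult_le_pos; [lra|left; apply Rinv_0_lt_compat; lra]|].
    apply (Rmult_le_reg_r (z - y)); [lra|]. unfold Rdiv.
    rewrite Rmult_assoc, Rinv_l; lra.
  - enough (y = z) by lra. apply NZ'.
    split; [apply Rmult_le_pos; [lra|left; apply Rinv_0_lt_compat; lra]|].
    apply (Rmult_le_reg_r (y - z)); [lra|]. unfold Rdiv.
    rewrite Rmult_assoc, Rinv_l; lra.
Qed.

Lemma gam_shift (X V : pt) (t l : R) :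
  g (padd X (pscale t V)) l = g X l + 2 * t * B X V l + t ^ 2 * B V V l.
Proof. unfold gam, bil, padd, pscale. simpl. ring. Qed.

Lemma bil_shift (X V : pt) (t l : R) :
  B (padd X (pscale t V)) V l = B X V l + t * B V V l.
Proof. unfold bil, padd, pscale. simpl. ring. Qed.

Lemma line_shift (X V : pt) (t : R) : line X V -> line (padd X (pscale t V)) V.
Proof.
  intros [HV HL]. split; [exact HV|]. intros x.
  rewrite <- HL, gam_shift, bil_shift. ring.
Qed.

Lemma line_scale (X V : pt) (s : R) : s <> 0 -> line X V -> line X (pscale s V).
Proof.
  intros Hs [HV HL].
  assert (E : dot (pscale s V) (pscale s V) = s ^ 2 * dot V V).
  { unfold dot, pscale. simpl. ring. }
  split.
  - rewrite E. apply Rmult_lt_0_compat; [apply pow2_pos; exact Hs|exact HV].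
  - intros x. rewrite E.
    transitivity (s ^ 2 * (B X V x ^ 2 - g X x * B V V x)).
    + unfold bil, pscale. simpl. ring.
    + rewrite HL. ring.
Qed.

Lemma phi_scale (X V : pt) (s u v : R) : phi u v X (pscale s V) = s * phi u v X V.
Proof. unfold phi, bil, pscale. simpl. ring. Qed.

(** * Chords *)

(** Zero discriminant at [c1] and [gam X c1 > 0] leave only the value 0 to exclude. In that case
    [bil V V] is [(x - c1) * h x] with [h] affine and increasing; its sign at [b] forces [h c1 < 0],
    while [residue] forces [h c1 > 0]. *)
Lemma first_gap_direction (X V : pt) : line X V -> g X 0 = 0 -> 0 < B V V c1.
Proof.
  intros HX H0. destruct (line_impact X V HX H0) as (m2 & m3 & M2 & M3 & Hg).
  destruct HX as [HV HL].
  assert (G : 0 < g X c1).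
  { rewrite Hg. replace ((c1 - 0) * (c1 - m2) * (c1 - m3))
      with (c1 * (m2 - c1) * (m3 - c1)) by ring.
    repeat apply Rmult_lt_0_compat; lra. }
  assert (E : B X V c1 ^ 2 = g X c1 * B V V c1).
  { specialize (HL c1). unfold quint in HL. lra. }
  assert (D : 0 <= B V V c1).
  { apply (Rmult_pos_reg_le (g X c1)); [exact G|]. rewrite <- E. apply pow2_ge_0. }
  destruct (Req_dec (B V V c1) 0) as [Z|]; [exfalso|lra].
  pose (D1 := - (px V * px V * (b + c) + py V * py V * (a + c) + pz V * pz V * (a + b))).
  pose (h := fun x => dot V V * (x + c1) + D1).
  assert (Hh : forall x, B V V x = (x - c1) * h x).
  { intros x. transitivity (B V V x - B V V c1); [rewrite Z; ring|].
    unfold bil, h, D1, dot. ring. }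
  assert (Hhb : h b <= 0).
  { apply Ropp_le_cancel. rewrite Ropp_0. apply (Rmult_pos_reg_le (b - c1)); [lra|].
    replace ((b - c1) * - h b) with (- B V V b) by (rewrite Hh; ring).
    pose proof (Rmult_le_pos _ _ (pow2_ge_0 (py V))
      (Rmult_le_pos (a - b) (b - c) ltac:(lra) ltac:(lra))). unfold bil. lra. }
  assert (Hh1 : h c1 < 0).
  { assert (0 < dot V V * (b - c1)) by (apply Rmult_lt_0_compat; lra).
    unfold h in *. lra. }
  destruct (bil_quadratic a b c X V) as (B0 & B1 & B2 & HB).
  pose proof (residue B0 B1 B2 c1 (fun x => (x - 0) * (x - m2) * (x - m3) * h x)
    (fun x => - (dot V V * ((x - c2) * (x - c3) * (x - c4) * (x - c5))))) as Res.
  cbv beta zeta in Res. rewrite <- Hg, <- HB in Res.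
  assert (Q : 0 < dot V V * ((c2 - c1) * (c3 - c1) * (c4 - c1) * (c5 - c1))).
  { repeat apply Rmult_lt_0_compat; lra. }
  assert (P : 0 < g X c1 * - h c1) by (apply Rmult_lt_0_compat; lra).
  enough (- (g X c1 * h c1)
    = - (dot V V * ((c1 - c2) * (c1 - c3) * (c1 - c4) * (c1 - c5)))) by lra.
  apply Res.
  - unfold h. reg.
  - reg.
  - rewrite Z, Rmult_0_r in E. apply Rsqr_0_uniq. unfold Rsqr. lra.
  - intros x. specialize (HL x). unfold quint in HL. rewrite Hh, HB in HL.
    rewrite <- Hg. lra.
Qed.

Lemma chord_polar (X V : pt) (t : R) : g X 0 = 0 -> g (padd X V) 0 = 0 ->
  g (padd X (pscale t V)) 0 = B V V 0 * (t * (t - 1)).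
Proof.
  intros H0 H1.
  replace V with (pscale 1 V) in H1 at 1
    by (unfold pscale; destruct V; simpl; f_equal; ring).
  rewrite gam_shift, H0 in H1 |- *.
  replace (2 * t * B X V 0) with (t * (2 * 1 * B X V 0)) by ring.
  replace (2 * 1 * B X V 0) with (- B V V 0) by lra. ring.
Qed.

Lemma direction_at_0 (X V : pt) : line X V -> 0 < B V V 0.
Proof.
  intros [HV _]. unfold dot in HV. unfold bil.
  assert (H : forall x, 0 <= x * x) by (intros x; apply Rle_0_sqr).
  (* A common lower bound for [b * c], [a * c] and [a * b]. *)
  set (k := c * c). assert (0 < k) by (apply Rmult_lt_0_compat; lra).
  pose proof (Rmult_lt_0_compat _ _ H0 HV) as P.
  assert (K : forall x y, c <= x -> c <= y -> 0 <= x * y - k).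
  { intros x y Hx Hy. unfold k. pose proof (Rmult_le_compat c x c y). lra. }
  pose proof (Rmult_le_pos _ _ (H (px V)) (K b c ltac:(lra) ltac:(lra))).
  pose proof (Rmult_le_pos _ _ (H (py V)) (K a c ltac:(lra) ltac:(lra))).
  pose proof (Rmult_le_pos _ _ (H (pz V)) (K a b ltac:(lra) ltac:(lra))).
  lra.
Qed.

Lemma chord_impacts (X V : pt) (t : R) : line X V -> g X 0 = 0 ->
  g (padd X V) 0 = 0 -> 0 <= t < 1 -> g (padd X (pscale t V)) 0 = 0 <-> t = 0.
Proof.
  intros HX H0 H1 Ht. rewrite chord_polar by assumption.
  pose proof (direction_at_0 X V HX). split.
  - intros E. apply Rmult_integral in E. destruct E as [E|E]; [lra|].
    apply Rmult_integral in E. lra.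
  - intros ->. ring.
Qed.

(** Along the line [gam] at [c1] is a positive multiple of the square of a nonconstant affine
    function, so it has one zero. There the least elliptic coordinate is [c1 > 0], which makes [gam]
    at 0 negative: the point is inside [Q], hence between the ends of the chord. *)
Lemma chord_first_gap (X V : pt) : line X V -> g X 0 = 0 -> g (padd X V) 0 = 0 ->
  exists t0, 0 < t0 < 1 /\ forall t, g (padd X (pscale t V)) c1 = 0 <-> t = t0.
Proof.
  intros HX H0 H1.
  pose proof (first_gap_direction X V HX H0) as D.
  assert (E : B X V c1 ^ 2 = g X c1 * B V V c1).
  { pose proof (proj2 HX c1) as HL. unfold quint in HL. lra. }
  assert (S : forall t, B V V c1 * g (padd X (pscale t V)) c1
                        = (B X V c1 + t * B V V c1) ^ 2).
  { intros t. rewrite gam_shift.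
    transitivity (g X c1 * B V V c1 + 2 * t * B X V c1 * B V V c1
      + t ^ 2 * B V V c1 ^ 2); [ring|]. rewrite <- E. ring. }
  assert (U : forall t, g (padd X (pscale t V)) c1 = 0 <-> t = - B X V c1 / B V V c1).
  { intros t. split; intros Ht.
    - specialize (S t). rewrite Ht, Rmult_0_r in S.
      assert (B X V c1 + t * B V V c1 = 0) by (apply Rsqr_0_uniq; unfold Rsqr; lra).
      apply (Rmult_eq_reg_r (B V V c1)); [|lra]. field_simplify; lra.
    - apply (Rmult_eq_reg_l (B V V c1)); [|lra]. rewrite S, Ht. field. lra. }
  exists (- B X V c1 / B V V c1). split; [|exact U].
  set (t0 := - B X V c1 / B V V c1) in *.
  pose proof (proj2 (U t0) eq_refl) as Z.
  destruct (line_elliptic _ _ (line_shift X V t0 HX)) as (m1 & m2 & m3 & M1 & M2 & M3 & Hg).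
  assert (m1 = c1) as ->.
  { rewrite Hg in Z.
    repeat (apply Rmult_integral in Z; destruct Z as [Z|Z]); lra. }
  pose proof (Hg 0) as G0. rewrite chord_polar in G0 by assumption.
  assert (0 < c1 * m2 * m3) by (repeat apply Rmult_lt_0_compat; lra).
  pose proof (direction_at_0 X V HX) as D0.
  assert (N : 0 < t0 * (1 - t0)).
  { apply (Rmult_lt_reg_l (B V V 0)); lra. }
  destruct (Rlt_dec 0 t0); destruct (Rlt_dec t0 1); try lra; exfalso.
  - pose proof (Rmult_le_pos t0 (t0 - 1) ltac:(lra) ltac:(lra)). lra.
  - pose proof (Rmult_le_pos (- t0) (1 - t0) ltac:(lra) ltac:(lra)). lra.
Qed.

Lemma confocal_gam (X : pt) (l : R) : confocal a b c l X <-> g X l = 0.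
Proof.
  assert (hcb : c < b) by lra. assert (hba : b < a) by lra.
  assert (Z : forall x k, k <> 0 -> x = 0 <-> x * x * k = 0).
  { intros x k Hk. split; intros H; [rewrite H; ring|].
    repeat (apply Rmult_integral in H; destruct H as [H|H]); tauto. }
  unfold confocal.
  destruct (Req_EM_T l a) as [->|Na]; [|destruct (Req_EM_T l b) as [->|Nb];
    [|destruct (Req_EM_T l c) as [->|Nc]]].
  - rewrite (Z (px X) ((b - a) * (c - a)))
      by (apply Rmult_integral_contrapositive_currified; lra).
    unfold gam, bil. split; intros H; lra.
  - rewrite (Z (py X) ((a - b) * (c - b)))
      by (apply Rmult_integral_contrapositive_currified; lra).
    unfold gam, bil. split; intros H; lra.
  - rewrite (Z (pz X) ((a - c) * (b - c)))
      by (apply Rmult_integral_contrapositive_currified; lra).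
    unfold gam, bil. split; intros H; lra.
  - assert (E : g X l = (a - l) * (b - l) * (c - l) *
      (px X ^ 2 / (a - l) + py X ^ 2 / (b - l) + pz X ^ 2 / (c - l) - 1)).
    { unfold gam, bil. field. lra. }
    assert (P : (a - l) * (b - l) * (c - l) <> 0).
    { repeat apply Rmult_integral_contrapositive_currified; lra. }
    rewrite E. split; intros H.
    + rewrite H. ring.
    + apply Rmult_integral in H. destruct H; [contradiction|lra].
Qed.

Lemma tangent_caustic_line (l1 l2 : R) (X V : pt) : l1 < l2 ->
  l1 <> a -> l1 <> b -> l1 <> c -> l2 <> a -> l2 <> b -> l2 <> c ->
  (forall x, (x - a) * (x - b) * (x - c) * (x - l1) * (x - l2) = quint c1 c2 c3 c4 c5 x) ->
  0 < dot V V -> line_tangent a b c l1 X V -> line_tangent a b c l2 X V -> line X V.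
Proof.
  intros Hl N1 N2 N3 N4 N5 N6 HQ HV T1 T2. split; [exact HV|]. intros x.
  (* [lx], [ly], [lz] are the squared components of the cross product of [X] and [V]. By a Lagrange
     identity the discriminant is [(a - y) * (b - y) * (c - y)] times a quadratic, which tangency
     makes vanish at [l1] and [l2]. Its zero cubic term fits it to [cubic_two_roots]. *)
  pose (lz := (px X * py V - py X * px V) ^ 2).
  pose (ly := (px X * pz V - pz X * px V) ^ 2).
  pose (lx := (py X * pz V - pz X * py V) ^ 2).
  pose (t1 := lx + ly + lz
     - (px V ^ 2 * (b + c) + py V ^ 2 * (a + c) + pz V ^ 2 * (a + b))).
  pose (t0 := - (lx * a + ly * b + lz * c)
     + (px V ^ 2 * (b * c) + py V ^ 2 * (a * c) + pz V ^ 2 * (a * b))).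
  assert (HT : forall y, B X V y ^ 2 - g X y * B V V y
     = (a - y) * (b - y) * (c - y) * (t0 + t1 * y + dot V V * y ^ 2 + 0 * y ^ 3)).
  { intros y. unfold t0, t1, lx, ly, lz, gam, bil, dot. ring. }
  assert (Root : forall l, l <> a -> l <> b -> l <> c -> line_tangent a b c l X V ->
     t0 + t1 * l + dot V V * l ^ 2 + 0 * l ^ 3 = 0).
  { intros l A1 A2 A3 T.
    assert (P : (a - l) * (b - l) * (c - l) <> 0).
    { repeat apply Rmult_integral_contrapositive_currified; lra. }
    apply (Rmult_eq_reg_l _ _ _) with (2 := P).
    rewrite <- HT, Rmult_0_r. unfold line_tangent in T. apply Rminus_diag_eq in T.
    transitivity (((a - l) * (b - l) * (c - l)) ^ 2 * 0); [|ring].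
    rewrite <- T. unfold gam, bil. field. lra. }
  rewrite HT, (cubic_two_roots t0 t1 (dot V V) 0 l1 l2) by (try apply Root; try assumption; lra).
  rewrite <- HQ. ring.
Qed.

Lemma gap_facts (X V : pt) (u v : R) : line X V -> gap u v ->
  quint c1 c2 c3 c4 c5 u = 0 /\ quint c1 c2 c3 c4 c5 v = 0 /\
  0 <= g X u /\ g X v <= 0 /\ (g X u <> 0 \/ g X v <> 0).
Proof.
  intros HX Huv. pose proof (line_signs X V HX) as S. unfold quint.
  destruct Huv as [[-> ->]|[-> ->]]; repeat split; try tauto; ring.
Qed.

(** [quadrant] expressed by [gam] and [phi] alone: no signs of square roots are chosen, so the
    states before and after an impact can be compared. For a counterclockwise point, [phi < 0] means
    [x * y > 0]. *)
Definition state (u v : R) (X V : pt) : nat :=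
  if Req_EM_T (g X v) 0 then 0%nat else if Req_EM_T (g X u) 0 then 1%nat
  else if Rlt_dec (phi u v X V) 0 then 1%nat else 0%nat.

Lemma padd_pscale_1 (X V : pt) : padd X (pscale 1 V) = padd X V.
Proof. unfold padd, pscale. simpl. rewrite !Rmult_1_l. reflexivity. Qed.

(** Both square roots are affine along the chord, [x'] and [y'] being their values at its end. Their
    Wronskian is constant and nonzero, and the free sign of [y] makes it positive. *)
Lemma chord_rotation (X V : pt) (u v : R) : line X V -> g X 0 = 0 -> gap u v ->
  exists x x' y y', 0 < x * y' - x' * y /\
    (forall t, g (padd X (pscale t V)) u = (x + t * (x' - x)) ^ 2) /\
    (forall t, g (padd X (pscale t V)) v = - (y + t * (y' - y)) ^ 2) /\
    state u v X V = quadrant x y /\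
    state u v (padd X V) V = quadrant x' y'.
Proof.
  intros HX H0 Huv.
  destruct (gap_facts X V u v HX Huv) as (Qu & Qv & Su & Sv & Suv).
  assert (Eu : B X V u ^ 2 = g X u * B V V u).
  { pose proof (proj2 HX u) as E. rewrite Qu in E. lra. }
  assert (Ev : (- B X V v) ^ 2 = - g X v * - B V V v).
  { pose proof (proj2 HX v) as E. rewrite Qv in E. lra. }
  assert (F : forall t, 0 <= g (padd X (pscale t V)) u /\ g (padd X (pscale t V)) v <= 0).
  { intros t. pose proof (gap_facts _ _ u v (line_shift X V t HX) Huv). tauto. }
  destruct (affine_square_root _ _ _ Eu) as (x & x1 & Gu & Bu & Du).
  { intros t. rewrite <- gam_shift. apply F. }
  destruct (affine_square_root _ _ _ Ev) as (y & y1 & Gv & Bv & Dv).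
  { intros t. pose proof (proj2 (F t)) as E. rewrite gam_shift in E. lra. }
  assert (Gv' : g X v = - y ^ 2) by lra. assert (Bv' : B X V v = - (y * y1)) by lra.
  assert (Dv' : B V V v = - y1 ^ 2) by lra. clear Gv Bv Dv.
  (* On an axis this is [line_direction_nonzero], off the axes it is [phi_neq_0] with [W = V]. *)
  assert (NW : x * y1 - x1 * y <> 0).
  { destruct (Req_dec x 0) as [->|Nx]; [|destruct (Req_dec y 0) as [->|Ny]].
    - pose proof (line_direction_nonzero X V u HX Qu ltac:(rewrite Gu; ring)) as N.
      rewrite Du in N. intros E. destruct Suv as [S|S]; [apply S; rewrite Gu; ring|].
      assert (Z : x1 * y = 0) by lra. apply Rmult_integral in Z.
      destruct Z as [->| ->]; [apply N|apply S; rewrite Gv']; ring.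
    - pose proof (line_direction_nonzero X V v HX Qv ltac:(rewrite Gv'; ring)) as N.
      rewrite Dv' in N. intros E.
      assert (Z : x * y1 = 0) by lra. apply Rmult_integral in Z.
      destruct Z as [Z| ->]; [contradiction|apply N; ring].
    - pose proof (phi_neq_0 X V V u v HX H0 Huv (fun _ _ _ => eq_refl) (Rle_refl _)) as N.
      unfold phi in N. rewrite Gu, Gv', Bu, Bv' in N. intros E. apply N.
      + apply pow_nonzero. exact Nx.
      + apply Ropp_neq_0_compat, pow_nonzero. exact Ny.
      + replace (x ^ 2 * - (y * y1) - x * x1 * - y ^ 2)
          with (- (x * y) * (x * y1 - x1 * y)) by ring.
        rewrite E. ring. }
  (* To be used with [(y, y1)] or [(- y, - y1)], according to the sign of the Wronskian. *)
  assert (Main : forall z z1, 0 < x * z1 - x1 * z -> g X v = - z ^ 2 ->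
    B X V v = - (z * z1) -> B V V v = - z1 ^ 2 ->
    exists x' y', 0 < x * y' - x' * z /\
    (forall t, g (padd X (pscale t V)) u = (x + t * (x' - x)) ^ 2) /\
    (forall t, g (padd X (pscale t V)) v = - (z + t * (y' - z)) ^ 2) /\
    state u v X V = quadrant x z /\ state u v (padd X V) V = quadrant x' y').
  { clear y y1 NW Ev Gv' Bv' Dv'. intros y y1 HW Gv Bv Dv.
    assert (Sq : forall s, s ^ 2 = 0 -> s = 0).
    { intros s Hs. apply Rsqr_0_uniq. unfold Rsqr. lra. }
    assert (St : forall Y s r, g Y u = s ^ 2 -> g Y v = - r ^ 2 ->
      phi u v Y V = - (s * r) * (x * y1 - x1 * y) -> state u v Y V = quadrant s r).
    { intros Y s r E1 E2 E3. unfold state, quadrant. rewrite E1, E2, E3.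
      destruct (Req_EM_T (- r ^ 2) 0) as [Z|Z], (Req_EM_T r 0) as [Z'|Z']; try reflexivity;
        [exfalso; apply Z', Sq; lra|exfalso; apply Z; rewrite Z'; ring|].
      destruct (Req_EM_T (s ^ 2) 0) as [W|W], (Req_EM_T s 0) as [W'|W']; try reflexivity;
        [exfalso; apply W', Sq; lra|exfalso; apply W; rewrite W'; ring|].
      destruct (Rlt_dec (- (s * r) * (x * y1 - x1 * y)) 0) as [L|L],
        (Rlt_dec 0 (s * r)) as [L'|L']; try reflexivity; exfalso.
      - apply L'. apply (Rmult_lt_reg_r (x * y1 - x1 * y)); lra.
      - apply L. pose proof (Rmult_lt_0_compat _ _ L' HW). lra. }
    exists (x + x1), (y + y1). split; [lra|]. split; [|split; [|split]].
    - intros t. rewrite gam_shift, Gu, Bu, Du. ring.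
    - intros t. rewrite gam_shift, Gv, Bv, Dv. ring.
    - apply St; try assumption. unfold phi. rewrite Gu, Gv, Bu, Bv. ring.
    - rewrite <- padd_pscale_1.
      apply St; unfold phi; rewrite ?gam_shift, ?bil_shift, ?Gu, ?Gv, ?Bu, ?Bv, ?Du, ?Dv; ring. }
  destruct (Rdichotomy _ _ NW) as [L|L].
  - destruct (Main (- y) (- y1)) as (x' & y' & H); try lra.
    exists x, x', (- y), y'. exact H.
  - destruct (Main y y1 L) as (x' & y' & H); try assumption.
    exists x, x', y, y'. exact H.
Qed.

(** Only the sign of [phi] depends on the direction; [phi_reflection] preserves it, and normalizing
    the directions scales [phi] by positive factors. *)
Lemma state_reflection (X V V' : pt) (u v : R) : onQ a b c X -> line X V -> line X V' ->
  gap u v ->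
  (let U := unit V in let N := normalQ a b c X in
   unit V' = psub U (pscale (2 * dot U N / dot N N) N)) ->
  state u v X V = state u v X V'.
Proof.
  intros HQ HV HV' Huv E. cbv zeta in E. unfold state.
  destruct (Req_EM_T (g X v) 0) as [|Nv]; [reflexivity|].
  destruct (Req_EM_T (g X u) 0) as [|Nu]; [reflexivity|].
  assert (P : forall Y, line X Y -> 0 < / pnorm Y).
  { intros Y [HY _]. apply Rinv_0_lt_compat, sqrt_lt_R0. exact HY. }
  pose proof (P V HV) as P1. pose proof (P V' HV') as P2.
  pose proof (phi_reflection X (unit V) u v HQ) as R. cbv zeta in R.
  rewrite <- E in R. unfold unit in R. rewrite !phi_scale in R.
  specialize (R (line_scale X V (/ pnorm V) ltac:(lra) HV) Huv Nu Nv).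
  assert (S : 0 < phi u v X V * phi u v X V').
  { apply (Rmult_lt_reg_l (/ pnorm V * / pnorm V')); [apply Rmult_lt_0_compat; assumption|].
    lra. }
  destruct (Rlt_dec (phi u v X V) 0), (Rlt_dec (phi u v X V') 0); try reflexivity;
    exfalso; nra.
Qed.

(** * Winding numbers *)

Section Trajectory.
Context (p : nat -> pt).
Local Notation V k := (psub (p (S k)) (p k)).
Context (traj : billiard_traj a b c p) (caustics : forall k, line (p k) (V k)).

Lemma padd_psub (X Y : pt) : padd X (psub Y X) = Y.
Proof. destruct X, Y. unfold padd, psub. simpl. f_equal; ring. Qed.

Lemma impact (k : nat) : g (p k) 0 = 0.
Proof. apply onQ_gam. apply traj. Qed.

Lemma caustics_next (k : nat) : line (p (S k)) (V k).
Proof.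
  pose proof (line_shift _ _ 1 (caustics k)) as H.
  rewrite padd_pscale_1, padd_psub in H. exact H.
Qed.

Lemma impact_count (n : nat) : points_on p n (confocal a b c 0) n.
Proof.
  apply points_on_uniform. intros k. apply (unit_points_one _ 0); [|lra].
  intros t Ht. rewrite confocal_gam. apply chord_impacts; try apply impact; auto.
  rewrite padd_psub. apply impact.
Qed.

Lemma first_gap_count (n : nat) : points_on p n (confocal a b c c1) n.
Proof.
  apply points_on_uniform. intros k.
  destruct (chord_first_gap (p k) (V k) (caustics k) (impact k)) as (t0 & Ht0 & H).
  { rewrite padd_psub. apply impact. }
  apply (unit_points_one _ t0); [|lra]. intros t Ht. rewrite confocal_gam. apply H.
Qed.

(** Induction on the number of chords: [rotation_crossings] telescopes because the states agree at
    impacts. The ratio [r] depends only on the vertex, so its monotonicity on single chords chains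
    as well. *)
Lemma gap_counts (u v : R) (n : nat) : gap u v ->
  let s k := state u v (p k) (V k) in
  let r k := g (p k) u / - g (p k) v in
  exists mu mv,
    points_on p n (confocal a b c u) mu /\ points_on p n (confocal a b c v) mv /\
    (mu + s n = mv + s 0%nat)%nat /\
    (mu = 0%nat -> mv = 0%nat -> g (p n) u <> 0 -> g (p n) v <> 0 ->
     n = 0%nat \/ (s 0%nat = 1%nat /\ r n < r 0%nat) \/
                  (s 0%nat = 0%nat /\ r 0%nat < r n)).
Proof.
  intros Huv s r. induction n as [|n (mu & mv & Hu & Hv & Hs & Hr)].
  { exists 0%nat, 0%nat. repeat split; auto using points_on_0. }
  destruct (chord_rotation (p n) (V n) u v (caustics n) (impact n) Huv)
    as (x & x' & y & y' & HW & Gu & Gv & S0 & S1).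
  rewrite padd_psub in S1.
  rewrite (state_reflection (p (S n)) (V n) (V (S n)) u v) in S1; try assumption;
    [|apply traj|apply caustics_next|apply caustics|apply traj].
  fold (s n) in S0. fold (s (S n)) in S1.
  assert (Sq : forall z, z ^ 2 = 0 <-> z = 0).
  { intros z. split; [intros H; apply Rsqr_0_uniq; unfold Rsqr; lra|intros ->; ring]. }
  exists (mu + crossing x x')%nat, (mv + crossing y y')%nat.
  assert (Gu0 : g (p n) u = x ^ 2).
  { specialize (Gu 0). rewrite gam_shift in Gu. lra. }
  assert (Gv0 : g (p n) v = - y ^ 2).
  { specialize (Gv 0). rewrite gam_shift in Gv. lra. }
  assert (Gu1 : g (p (S n)) u = x' ^ 2).
  { specialize (Gu 1). rewrite padd_pscale_1, padd_psub in Gu. rewrite Gu. ring. }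
  assert (Gv1 : g (p (S n)) v = - y' ^ 2).
  { specialize (Gv 1). rewrite padd_pscale_1, padd_psub in Gv. rewrite Gv. ring. }
  split; [|split; [|split]].
  - apply points_on_S; [exact Hu|].
    apply unit_points_ext with (2 := affine_zeros x x' ltac:(intros -> ->; lra)).
    intros t. rewrite confocal_gam. unfold seg. rewrite Gu, Sq. reflexivity.
  - apply points_on_S; [exact Hv|].
    apply unit_points_ext with (2 := affine_zeros y y' ltac:(intros -> ->; lra)).
    intros t. rewrite confocal_gam. unfold seg. rewrite Gv, <- Sq. split; lra.
  - pose proof (rotation_crossings x y x' y' HW). lia.
  - intros Zu Zv Nu Nv. right.
    rewrite Gu1, Sq in Nu. rewrite Gv1 in Nv.
    assert (Ny' : y' <> 0) by (intros E; apply Nv; rewrite E; ring).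
    assert (Cx : crossing x x' = 0%nat) by lia. assert (Cy : crossing y y' = 0%nat) by lia.
    destruct (crossing_0 x x' Cx Nu) as [Nx _]. destruct (crossing_0 y y' Cy Ny') as [Ny _].
    assert (E0 : r n = x ^ 2 / y ^ 2) by (unfold r; rewrite Gu0, Gv0, Ropp_involutive; reflexivity).
    assert (E1 : r (S n) = x' ^ 2 / y' ^ 2)
      by (unfold r; rewrite Gu1, Gv1, Ropp_involutive; reflexivity).
    pose proof (rotation_ratio x y x' y' HW Cx Cy Nu Ny') as R.
    rewrite <- S0, <- E0, <- E1 in R.
    specialize (Hr ltac:(lia) ltac:(lia)).
    rewrite Gu0, Gv0 in Hr.
    specialize (Hr ltac:(rewrite Sq; exact Nx) ltac:(intros E; apply Ny, Sq; lra)).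
    (* Without zeros the state is the same at both vertices, so [r] has moved in the same sense
       throughout. *)
    replace (s n) with (s 0%nat) in R by lia.
    destruct Hr as [->|[[? ?]|[? ?]]]; [exact R| |];
      destruct R as [[? ?]|[? ?]]; try lia; [left|right]; split; try assumption; lra.
Qed.

(** After a period the state returns, so the two counts agree. If they were zero, the ratio would
    have changed strictly, yet it returns too. *)
Lemma gap_winding_number (u v : R) (n : nat) : gap u v ->
  (0 < n)%nat -> p n = p 0%nat -> p (S n) = p 1%nat ->
  exists m, (0 < m)%nat /\
    points_on p n (confocal a b c u) m /\ points_on p n (confocal a b c v) m.
Proof.
  intros Huv Hn P0 P1.
  destruct (gap_counts u v n Huv) as (mu & mv & Hu & Hv & Hs & Hr).
  rewrite P0, P1 in Hs. rewrite P0 in Hr. assert (mv = mu) as -> by lia.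
  exists mu. split; [|tauto].
  destruct mu; [exfalso|lia].
  assert (Z : forall l, points_on p n (confocal a b c l) 0 -> g (p 0%nat) l <> 0).
  { intros l Hl E. apply (points_on_none p n 0 0 _ Hl Hn); [lra|].
    apply confocal_gam. unfold seg. rewrite gam_shift, E. ring. }
  destruct (Hr eq_refl eq_refl (Z u Hu) (Z v Hv)) as [->|[[_ E]|[_ E]]];
    [lia| |]; revert E; apply Rlt_irrefl.
Qed.

(** At a vertex on the plane [f = 0] the normal of [Q] lies in that plane, so the unit velocities
    before and after have the same [f]-component. *)
Lemma coordinate_reflection (k : nat) (f : pt -> R) :
  (forall X Y, f (psub X Y) = f X - f Y) -> (forall t X, f (pscale t X) = t * f X) ->
  (f (p (S k)) = 0 -> f (normalQ a b c (p (S k))) = 0) ->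
  f (p (S k)) = 0 -> f (V k) <> 0 -> 0 < f (V k) * f (V (S k)).
Proof.
  intros Fs Fm Fn Z NV.
  destruct traj as (_ & _ & R). specialize (R k). cbv zeta in R.
  apply (f_equal f) in R. rewrite Fs, Fm, (Fn Z), Rmult_0_r, Rminus_0_r in R.
  unfold unit in R. rewrite !Fm in R.
  assert (P : forall j, 0 < / pnorm (V j)).
  { intros j. apply Rinv_0_lt_compat, sqrt_lt_R0, caustics. }
  pose proof (P k) as P1. pose proof (P (S k)) as P2.
  apply (Rmult_lt_reg_l (/ pnorm (V (S k)))); [exact P2|].
  replace (/ pnorm (V (S k)) * (f (V k) * f (V (S k))))
    with (f (V k) * (/ pnorm (V (S k)) * f (V (S k)))) by ring.
  rewrite R, Rmult_0_r.
  pose proof (Rmult_lt_0_compat _ _ P1 (pow2_pos _ NV)). lra.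
Qed.

Lemma coordinate_plane_even (n : nat) (f : pt -> R) (e kf : R) :
  (forall X Y, f (psub X Y) = f X - f Y) -> (forall X Y, f (padd X Y) = f X + f Y) ->
  (forall t X, f (pscale t X) = t * f X) ->
  (forall X, f X = 0 -> f (normalQ a b c X) = 0) ->
  quint c1 c2 c3 c4 c5 e = 0 -> (forall X, g X e = kf * f X ^ 2) ->
  (forall X, B X X e = kf * f X ^ 2) ->
  p n = p 0%nat -> p (S n) = p 1%nat ->
  exists j, points_on p n (fun X => f X = 0) (2 * j).
Proof.
  intros Fs Fa Fm Fn He Fg FB P0 P1.
  assert (NV : forall X Y, line X Y -> f X = 0 -> f Y <> 0).
  { intros X Y HX Z E. apply (line_direction_nonzero X Y e HX He).
    - rewrite Fg, Z. ring.
    - rewrite FB, E. ring. }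
  apply even_crossings; try assumption.
  - intros k t. unfold seg. rewrite Fa, Fm. reflexivity.
  - intros k. apply Fs.
  - intros k. apply NV, caustics.
  - intros k Z. apply coordinate_reflection; auto.
    apply (NV (p (S k))); [apply caustics_next|exact Z].
Qed.

Lemma confocal_even (n : nat) (e : R) (m : nat) : (e = a \/ e = b \/ e = c) ->
  p n = p 0%nat -> p (S n) = p 1%nat ->
  points_on p n (confocal a b c e) m -> exists j, m = (2 * j)%nat.
Proof.
  intros He P0 P1 Hm.
  assert (hcb : c < b) by lra. assert (hba : b < a) by lra.
  assert (Q : quint c1 c2 c3 c4 c5 e = 0).
  { unfold quint. destruct He as [->|[->| ->]]; [rewrite ha| |].
    - ring.
    - destruct hb as [->| ->]; ring.
    - destruct hc as [->| ->]; ring. }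
  assert (Fin : forall f : pt -> R, (forall X, confocal a b c e X <-> f X = 0) ->
    (exists j, points_on p n (fun X => f X = 0) (2 * j)) -> exists j, m = (2 * j)%nat).
  { intros f Hf (j & l & Nl & Ll & Hl). exists j.
    apply (points_on_unique p n _ _ _ Hm). exists l. split; [exact Nl|split; [exact Ll|]].
    intros k t. rewrite Hl, Hf. reflexivity. }
  destruct He as [->|[->| ->]].
  - apply (Fin px).
    + intros X. unfold confocal. destruct (Req_EM_T a a); [reflexivity|contradiction].
    + apply (coordinate_plane_even n px a ((b - a) * (c - a))); try assumption;
        try reflexivity; intros X; try (unfold gam); unfold bil, normalQ; simpl; try ring.
      intros ->. unfold Rdiv. ring.
  - apply (Fin py).
    + intros X. unfold confocal. destruct (Req_EM_T b a); [lra|].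
      destruct (Req_EM_T b b); [reflexivity|contradiction].
    + apply (coordinate_plane_even n py b ((a - b) * (c - b))); try assumption;
        try reflexivity; intros X; try (unfold gam); unfold bil, normalQ; simpl; try ring.
      intros ->. unfold Rdiv. ring.
  - apply (Fin pz).
    + intros X. unfold confocal. destruct (Req_EM_T c a); [lra|].
      destruct (Req_EM_T c b); [lra|]. destruct (Req_EM_T c c); [reflexivity|contradiction].
    + apply (coordinate_plane_even n pz c ((a - c) * (b - c))); try assumption;
        try reflexivity; intros X; try (unfold gam); unfold bil, normalQ; simpl; try ring.
      intros ->. unfold Rdiv. ring.
Qed.
End Trajectory.
End Frame.

(** The four types differ only in which of [c1], [c2] is [c] and which of [c3], [c4] is [b]. Since
    [c5 = a], [m2] is even and positive, so [m2 >= 2], [m1 >= 3], [n >= 4]. A coordinate plane at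
    [c2] or [c3] makes [m1] even, hence at least 4; one at [c1] makes [n] even. *)
Lemma winding_bounds (a b c c1 c2 c3 c4 c5 lam1 lam2 : R) (p : nat -> pt) (n : nat) :
  0 < c1 -> c1 < c2 -> c2 < c3 -> c3 < c4 -> c4 < c5 ->
  c = c1 \/ c = c2 -> b = c3 \/ b = c4 -> a = c5 ->
  (forall x, (x - a) * (x - b) * (x - c) * (x - lam1) * (x - lam2)
             = quint c1 c2 c3 c4 c5 x) ->
  Permutation (c1 :: c2 :: c3 :: c4 :: c5 :: nil) (a :: b :: c :: lam1 :: lam2 :: nil) ->
  nonsingular_caustics a b c lam1 lam2 -> winding_conjecture a b c ->
  billiard_traj a b c p -> periodic_with p n -> has_caustics a b c p lam1 lam2 ->
  (4 <= n)%nat /\ (c = c2 \/ b = c3 -> (5 <= n)%nat) /\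
  (c = c1 -> b = c3 -> (6 <= n)%nat).
Proof.
  intros h1 h2 h3 h4 h5 hc hb ha HQ HP NS HW traj [Hn per] caus.
  assert (lines : forall k,
    caustic_line a b c c1 c2 c3 c4 c5 (p k) (psub (p (S k)) (p k))).
  { intros k. destruct NS as (? & ? & ? & ? & ? & ? & ? & ?).
    destruct (proj2 caus k) as [T1 T2].
    apply tangent_caustic_line with (l1 := lam1) (l2 := lam2); try assumption.
    destruct traj as (_ & Hne & _). specialize (Hne k).
    destruct (p (S k)) as [x y z], (p k) as [x' y' z']. unfold dot, psub. simpl.
    assert (P : forall t, 0 <= t * t) by (intros t; apply Rle_0_sqr).
    pose proof (P (x - x')). pose proof (P (y - y')). pose proof (P (z - z')).
    destruct (Req_dec x x') as [->|Nx]; [destruct (Req_dec y y') as [->|Ny];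
      [destruct (Req_dec z z') as [->|Nz]; [contradiction|]|]|].
    - pose proof (pow2_pos (z - z')). lra.
    - pose proof (pow2_pos (y - y')). lra.
    - pose proof (pow2_pos (x - x')). lra. }
  pose proof (per 0%nat) as P0. pose proof (per 1%nat) as P1. simpl in P0, P1.
  assert (Gap : forall u v, gap c2 c3 c4 c5 u v -> exists m, (0 < m)%nat /\
    points_on p n (confocal a b c u) m /\ points_on p n (confocal a b c v) m).
  { intros u v Huv. eapply gap_winding_number; eassumption. }
  destruct (Gap c2 c3) as (m1 & Pm1 & W2 & W3); [left; auto|].
  destruct (Gap c5 c4) as (m2 & Pm2 & W5 & W4); [right; auto|].
  assert (W0 : points_on p n (confocal a b c 0) n) by (eapply impact_count; eassumption).
  assert (W1 : points_on p n (confocal a b c c1) n) by (eapply first_gap_count; eassumption).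
  assert (Even : forall e m, e = a \/ e = b \/ e = c ->
    points_on p n (confocal a b c e) m -> exists j, m = (2 * j)%nat).
  { intros e m He. apply (confocal_even a b c c1 c2 c3 c4 c5) with (p := p) (n := n) (e := e); assumption. }
  destruct (HW p n lam1 lam2 n m1 m2) as [L1 L0]; try assumption.
  { split; assumption. }
  { exists c1, c2, c3, c4, c5. tauto. }
  destruct (Even c5 m2 ltac:(left; congruence) W5) as (j2 & E2).
  split; [lia|split].
  - intros [E|E].
    + destruct (Even c2 m1 ltac:(right; right; congruence) W2) as (j1 & E1). lia.
    + destruct (Even c3 m1 ltac:(right; left; congruence) W3) as (j1 & E1). lia.
  - intros E E'.
    destruct (Even c1 n ltac:(right; right; congruence) W1) as (j0 & E0).
    destruct (Even c3 m1 ltac:(right; left; congruence) W3) as (j1 & E1). lia.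
Qed.

Theorem theorem1 (a b c : R) (hcb : 0 < c) (hbc : c < b) (hab : b < a) :
  winding_conjecture a b c ->
  forall (p : nat -> pt) (n : nat) (lam1 lam2 : R),
    billiard_traj a b c p -> periodic_with p n ->
    has_caustics a b c p lam1 lam2 ->
    (type_EH1 a b c lam1 lam2 -> (5 <= n)%nat) /\
    (type_H1H1 a b c lam1 lam2 -> (4 <= n)%nat) /\
    (type_EH2 a b c lam1 lam2 -> (5 <= n)%nat) /\
    (type_H1H2 a b c lam1 lam2 -> (6 <= n)%nat).
Proof.
  intros HW p n lam1 lam2 traj per caus.
  assert (NS : (0 < lam1 < c \/ c < lam1 < b) -> (c < lam2 < b \/ b < lam2 < a) ->
    lam1 < lam2 -> nonsingular_caustics a b c lam1 lam2).
  { intros H1 H2 H3. unfold nonsingular_caustics. repeat split; try lra; intros E; lra. }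
  repeat split; intros T; red in T.
  (* EH1: [c] is [c2], so [m1] is even. *)
  - apply (winding_bounds a b c lam1 c lam2 b a lam1 lam2 p n);
      try assumption; try lra; try (apply NS; lra).
    + intros x. unfold quint. ring.
    + apply (Permutation_cons_app (a :: b :: c :: nil) (lam2 :: nil)).
      apply (Permutation_cons_app (a :: b :: nil) (lam2 :: nil)).
      apply (Permutation_cons_app (a :: b :: nil) nil). apply perm_swap.
  (* H1H1: both caustics count towards [m1], whose parity stays free. *)
  - apply (winding_bounds a b c c lam1 lam2 b a lam1 lam2 p n);
      try assumption; try lra; try (apply NS; lra).
    + intros x. unfold quint. ring.
    + apply (Permutation_cons_app (a :: b :: nil) (lam1 :: lam2 :: nil)).
      apply (Permutation_cons_app (a :: b :: nil) (lam2 :: nil)).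
      apply (Permutation_cons_app (a :: b :: nil) nil). apply perm_swap.
  (* EH2: [c] and [b] are [c2] and [c3], so [m1] is even. *)
  - apply (winding_bounds a b c lam1 c b lam2 a lam1 lam2 p n);
      try assumption; try lra; try (apply NS; lra).
    + intros x. unfold quint. ring.
    + apply (Permutation_cons_app (a :: b :: c :: nil) (lam2 :: nil)).
      apply (Permutation_cons_app (a :: b :: nil) (lam2 :: nil)).
      apply (Permutation_cons_app (a :: nil) (lam2 :: nil)). apply perm_swap.
  (* H1H2: [c] is [c1] and [b] is [c3], so [n] and [m1] are both even. *)
  - apply (winding_bounds a b c c lam1 b lam2 a lam1 lam2 p n);
      try assumption; try lra; try (apply NS; lra).
    + intros x. unfold quint. ring.
    + apply (Permutation_cons_app (a :: b :: nil) (lam1 :: lam2 :: nil)).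
      apply (Permutation_cons_app (a :: b :: nil) (lam2 :: nil)).
      apply (Permutation_cons_app (a :: nil) (lam2 :: nil)). apply perm_swap.
Qed.
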